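(* For $x\in X$ and $z\in\mathbb{T}$ define $\psi_{x,z}\big(\sum_k f_k\delta^k\big)=\sum_k f_k(x)z^k$ for $\sum_k f_k\delta^k\in C(X)'_1$. Then $\psi:(x,z)\mapsto\psi_{x,z}$ is a continuous surjection $X\times\mathbb{T}\to\Delta(C(X)'_1)$, and $\Delta(C(X)'_1)$ is the topological quotient of $X\times\mathbb{T}$ via $\psi$. The fibers are: (i) for $x\notin\bigcup_{q\ge1}\mathrm{Fix}_q(\sigma)^\circ$: $\psi^{-1}(\{\omega_x\})=\{x\}\times\mathbb{T}$; (ii) for $x\in\bigcup_{q\ge1}\mathrm{Fix}_q(\sigma)^\circ$ and $c\in\mathbb{T}$: $\psi^{-1}(\{\omega_{x,c}\})=\{(x,z):z\in\mathbb{T},\ z^n=c\}$, where $n$ is the minimal $n\ge1$ such that $x\in\mathrm{Fix}_n(\sigma)^\circ$.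
   Context: Let $X$ be a non-empty compact Hausdorff space and $\sigma:X\to X$ a homeomorphism. For $n\in\mathbb{Z}$ let $\mathrm{Fix}_n(\sigma)=\{x:\sigma^nx=x\}$; a superscript $\circ$ denotes interior, $\mathrm{supp}(f)$ the closure of $\{f\ne0\}$. $C(X)$ is the algebra of continuous complex functions with sup norm, $\alpha(f)=f\circ\sigma^{-1}$. $\ell^1(\Sigma)$ is the set of $\ell:\mathbb{Z}\to C(X)$ with $\|\ell\|=\sum_k\|\ell(k)\|_\infty<\infty$, product $(\ell\ell')(n)=\sum_k\ell(k)\alpha^k(\ell'(n-k))$, involution $\ell^*(n)=\overline{\alpha^n(\ell(-n))}$. With $\delta$ the element equal to the constant $1$ at $1\in\mathbb{Z}$ and $0$ elsewhere, each element is uniquely $\sum_k f_k\delta^k$, $f_k=\ell(k)$. $C(X)'_1$, the commutant of $C(X)$ (embedded as $\{f\delta^0\}$) in $\ell^1(\Sigma)$, equals $\{\sum_kf_k\delta^k:\mathrm{supp}(f_k)\subset\mathrm{Fix}_k(\sigma)\ \forall k\}$ and is commutative; $\Delta(C(X)'_1)$ is its maximal ideal space with the Gelfand topology. For $x\notin\bigcup_{q\ge1}\mathrm{Fix}_q(\sigma)^\circ$, $\omega_x$ is the character $\sum_kf_k\delta^k\mapsto f_0(x)$; for $x\in\bigcup_{q\ge1}\mathrm{Fix}_q(\sigma)^\circ$ and $c\in\mathbb{T}$, $\omega_{x,c}$ is the character $\sum_kf_k\delta^k\mapsto\sum_jf_{jn}(x)c^j$, with $n$ the minimal $n\ge1$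 such that $x\in\mathrm{Fix}_n(\sigma)^\circ$. These are exactly all characters of $C(X)'_1$, without repetition. *)

(* Defs.v *)
From HB Require Import structures.
From mathcomp Require Import all_boot all_order all_algebra.
From mathcomp Require Import all_classical all_reals all_analysis.
From mathcomp Require Import complex.
Set Implicit Arguments. Unset Strict Implicit. Unset Printing Implicit Defensive.
Import Order.TTheory GRing.Theory Num.Theory numFieldNormedType.Exports.
Local Open Scope ring_scope.
Local Open Scope classical_set_scope.

Definition Cplx (R : realType) := ((R[i])^o : normedModType (R[i])).

Definition cabs (R : realType) (z : Cplx R) : R := ComplexField.Normc.normc (z : R[i]).

Definition circle (R : realType) : set (Cplx R) := [set z | cabs z = 1].

Definition sumZ (R : realType) (u : int -> Cplx R) : Cplx R :=
  limn (fun N => \sum_(0 <= k < N) u (Posz k))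
  + limn (fun N => \sum_(0 <= k < N) u (Negz k)).

Section Crossed.
Variables (R : realType) (X : topologicalType) (sigma sigmai : X -> X).

(* sigma^k for k in Z (sigmai is the inverse of sigma) *)
Definition iterz (k : int) (x : X) : X :=
  match k with
  | Posz n => iter n sigma x
  | Negz n => iter n.+1 sigmai x
  end.

Definition Fix (n : int) : set X := [set x | iterz n x = x].

Definition supn (f : X -> Cplx R) : R := sup [set cabs (f x) | x in [set: X]].

Definition in_l1 (a : int -> X -> Cplx R) : Prop :=
  (forall k, continuous (a k)) /\
  (\esum_(k in [set: int]) (supn (a k))%:E < +oo)%E.

(* C(X)'_1 = { sum f_k delta^k in ell^1 : supp f_k subset Fix_k(sigma) } *)
Definition in_comm (a : int -> X -> Cplx R) : Prop :=
  in_l1 a /\ forall k, closure [set x | a k x != 0] `<=` Fix k.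

Record Comm := MkComm { cval :> int -> X -> Cplx R; cvalP : in_comm cval }.

(* product in ell^1(Sigma): (l l')(n) = sum_k l(k) alpha^k(l'(n-k)),
   alpha(f) = f o sigma^{-1}, so alpha^k(g)(x) = g(sigma^{-k} x) *)
Definition l1mul (a b : int -> X -> Cplx R) : int -> X -> Cplx R :=
  fun n x => sumZ (fun k => a k x * b (n - k) (iterz (- k) x)).

Definition is_character (phi : Comm -> Cplx R) : Prop :=
  [/\ forall a b c : Comm, cval c = (fun k x => a k x + b k x) -> phi c = phi a + phi b,
      forall (l : Cplx R) (a c : Comm), cval c = (fun k x => l * a k x) -> phi c = l * phi a,
      forall a b c : Comm, cval c = l1mul a b -> phi c = phi a * phi b
    & exists a : Comm, phi a != 0].

Definition gelfand_open (U : set (Comm -> Cplx R)) : Prop :=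
  forall phi, U phi -> exists (m : nat) (a : 'I_m -> Comm) (e : R), 0 < e /\
    forall phi', is_character phi' ->
      (forall i, cabs (phi' (a i) - phi (a i)) < e) -> U phi'.

Definition psi (x : X) (z : Cplx R) : Comm -> Cplx R :=
  fun a => sumZ (fun k => a k x * z ^ k).

Definition omega0 (x : X) : Comm -> Cplx R := fun a => a 0 x.

(* omega_{x,c}, n the minimal period *)
Definition omega (x : X) (c : Cplx R) (n : nat) : Comm -> Cplx R :=
  fun a => sumZ (fun j => a (j * n%:Z) x * c ^ j).

Definition open_in_XT (W : set (X * Cplx R)) : Prop :=
  exists V : set (X * Cplx R), open V /\
    W `&` [set p | circle p.2] = V `&` [set p | circle p.2].

End Crossed.

Arguments psi [R X] sigma sigmai x z _.
Arguments omega [R X] sigma sigmai x c n%_nat_scope _.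

(* Main.v *)
(* A character phi of the Banach algebra A = C(X)'_1 is contractive: if
   |phi(a)| > ||a||, then a' = a / phi(a) has a quasi-inverse b = a' + a' b,
   and applying phi gives phi(b) = 1 + phi(b).  The restriction of phi to C(X) is
   evaluation at some x.  If f vanishes at x and is supported in Fix_k, then
   phi(f delta^k) = phi(f h delta^k) for every h with h(x) = 1; taking
   h = 1 / (1 + |f|/e) makes ||f h|| <= e, hence phi(f delta^k) = 0.  If f(x) <> 0,
   then k lies in the subgroup nZ = {k : x in the interior of Fix_k}; a Urysohn
   function u at x supported in Fix_n makes w = phi(u delta^n) unimodular and
   phi(f delta^(jn)) = f(x) w^j, so every z with z^n = w gives
   phi(f delta^k) = f(x) z^k for all k, and phi = psi_(x,z) by continuity of phi.

   The map psi is continuous by dominated convergence; it is a quotient map because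
   X x T is compact and the Gelfand topology is Hausdorff.  The
   fibres are computed by testing psi on monomials f delta^k. *)

Require Import Defs.
From HB Require Import structures.
From mathcomp Require Import all_boot all_order all_algebra.
From mathcomp Require Import all_classical all_reals all_analysis.
From mathcomp Require Import complex.
From mathcomp Require Import ring lra zify.
Import Order.TTheory GRing.Theory Num.Theory numFieldNormedType.Exports.
Local Open Scope ring_scope.
Local Open Scope classical_set_scope.

Set Implicit Arguments.
Unset Strict Implicit.
Unset Printing Implicit Defensive.

(** * The modulus on complex numbers *)

(** The definition of a character asks for no continuity, no unit and no compatibility with the
    involution. Boundedness therefore has to come from completeness, and the unimodularity of w from
    the fact that both w and its inverse are values of the character on elements of norm at most 1.
    The twist in the product is harmless on the commutant: where a_k(x) is nonzero, sigma^k fixes x.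
    At a fixed x the map sending a to the sequence (a_k(x))_k is thus a homomorphism into the
    convolution algebra l^1(Z), and psi_(x,z) is this map followed by the Fourier character at z.
    Identities between complex double sums become statements about scalar sequences; they are proved
    by checking a bounded additive functional on one-point sequences, and sums are exchanged only
    for nonnegative weights. Norms are unordered sums while [sumZ] is a sum of two ordered limits;
    truncation by [zrank] links the two. *)

Section CplxNorm.
Variable R : realType.
Implicit Types x y z : Cplx R.

Lemma normr_cabs z : `|z| = (cabs z)%:C%C.
Proof. by []. Qed.

Lemma cabs_ge0 z : 0 <= cabs z.
Proof. by rewrite -ler0c -normr_cabs normr_ge0. Qed.

Lemma cabs0 : cabs (0 : Cplx R) = 0.
Proof. exact: ComplexField.Normc.normc0. Qed.

Lemma cabs1 : cabs (1 : Cplx R) = 1.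
Proof. exact: ComplexField.Normc.normc1. Qed.

Lemma cabs_eq0 z : cabs z = 0 -> z = 0.
Proof. exact: ComplexField.Normc.eq0_normc. Qed.

Lemma cabsM x y : cabs (x * y) = cabs x * cabs y.
Proof. exact: ComplexField.Normc.normcM. Qed.

Lemma cabsN x : cabs (- x) = cabs x.
Proof. exact: normcN. Qed.

Lemma cabsD x y : cabs (x + y) <= cabs x + cabs y.
Proof. exact: le_normcD. Qed.

Lemma cabsB x y : cabs (x - y) = cabs (y - x).
Proof. by rewrite -cabsN opprB. Qed.

Lemma cabs_dist x y z : cabs (x - z) <= cabs (x - y) + cabs (y - z).
Proof. by rewrite -[x - z](subrKA y) cabsD. Qed.

Lemma cabsV x : cabs (x^-1) = (cabs x)^-1.
Proof. exact: ComplexField.Normc.normcV. Qed.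

Lemma cabsX x n : cabs (x ^+ n) = cabs x ^+ n.
Proof. by elim: n => [|n IH]; rewrite ?expr0 ?cabs1// !exprS cabsM IH. Qed.

Lemma circle_expz z k : circle z -> cabs (z ^ k) = 1.
Proof.
move=> z1; case: k => n; first by rewrite -exprnP cabsX z1 expr1n.
by rewrite NegzE -exprnN cabsV cabsX z1 expr1n invr1.
Qed.

Lemma cabs_real (r : R) : cabs (r%:C%C : Cplx R) = `|r|.
Proof. by rewrite /cabs /= expr0n /= addr0 sqrtr_sqr. Qed.

Lemma cabs_sum I (s : seq I) (P : pred I) (F : I -> Cplx R) :
  cabs (\sum_(i <- s | P i) F i) <= \sum_(i <- s | P i) cabs (F i).
Proof.
elim/big_ind2 : _ => // [|u1 u2 v1 v2 h1 h2]; first by rewrite cabs0.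
by rewrite (le_trans (cabsD _ _))// lerD.
Qed.

Lemma Re_le_cabs z : `|complex.Re (z : R[i])| <= cabs z.
Proof.
case: z => a b; rewrite /cabs /= -sqrtr_sqr ler_wsqrtr//.
by rewrite lerDl sqr_ge0.
Qed.

Lemma Im_le_cabs z : `|complex.Im (z : R[i])| <= cabs z.
Proof.
case: z => a b; rewrite /cabs /= -sqrtr_sqr ler_wsqrtr//.
by rewrite lerDr sqr_ge0.
Qed.

Lemma cabs_le_ReIm z : cabs z <= `|complex.Re (z : R[i])| + `|complex.Im (z : R[i])|.
Proof.
case: z => a b.
have -> : (a +i* b)%C = (a%:C + b%:C * 'i)%C by rewrite [LHS]complexE mulrC.
apply: le_trans (cabsD _ _) _.
rewrite cabsM !cabs_real /= !(mul0r, mulr0, subr0, mul1r, mulr1, addr0, add0r).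
by rewrite /cabs /= expr0n /= expr1n add0r sqrtr1 mulr1.
Qed.

(** The norm of [Cplx R] takes values in [R[i]], so the radii of its balls are complex; being
    positive, they are real, and real radii suffice. *)
Lemma cvg_cplxP (T : Type) (F : set_system T) (FF : Filter F)
    (f : T -> Cplx R) (l : Cplx R) :
  (f @ F --> l) <-> forall e : R, 0 < e -> \forall t \near F, cabs (f t - l) < e.
Proof.
split=> [/cvgrPdist_lt h e e0|h].
- have e0' : 0 < (e%:C)%C :> R[i] by rewrite ltcR.
  near do rewrite cabsB -ltcR -normr_cabs.
  exact: h.
- apply/cvgrPdist_lt => e e0.
  have /RRe_real ee : e \is Num.real by rewrite ger0_real// ltW.
  have e0' : 0 < complex.Re e by rewrite -ltcR ee.
  near do rewrite -ee normr_cabs ltcR cabsB.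
  exact: h.
Unshelve. all: by end_near. Qed.

Lemma continuous_cabs (T : topologicalType) (f : T -> Cplx R) (x : T) :
  {for x, continuous f} -> {for x, continuous (fun t => cabs (f t))}.
Proof.
move=> /cvg_cplxP cf; apply/cvgrPdist_lt => e /cf.
apply: filterS => t; apply: le_lt_trans.
rewrite ler_norml; apply/andP; split.
- rewrite lerNl opprB lerBlDl.
  by rewrite -{1}[f t](subrK (f x)) addrC cabsD.
- by rewrite lerBlDl cabsB -{1}[f x](subrK (f t)) addrC cabsD.
Qed.

Lemma continuous_RtoC (T : topologicalType) (f : T -> R) (x : T) :
  {for x, continuous f} ->
  {for x, continuous (fun t => (f t)%:C%C : Cplx R)}.
Proof.
move=> /cvgrPdist_lt cf; apply/cvg_cplxP => e /cf.
by apply: filterS => t; rewrite -rmorphB cabs_real distrC.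
Qed.

(** The intervals of radius [e n] around [v n] meet pairwise, so the supremum of their left
    endpoints lies in all of them. If [e] tends to 0, this point is the limit, with a rate. *)
Lemma real_tail_limit (v e : nat -> R) :
  (forall n m, (n <= m)%N -> `|v m - v n| <= e n) ->
  exists l, forall n, `|l - v n| <= e n.
Proof.
move=> h; pose A := range (fun n => v n - e n).
have ub n m : v n - e n <= v m + e m.
  have := h n _ (leq_maxl n m); have := h m _ (leq_maxr n m).
  rewrite !ler_norml; lra.
have hA : has_sup A.
  split; first by exists (v 0%N - e 0%N), 0%N.
  by exists (v 0%N + e 0%N) => _ [n _ <-].
exists (sup A) => n; rewrite ler_norml; apply/andP; split.
- by rewrite lerBrDl; apply: ub_le_sup; [exact: hA.2|exists n].
- rewrite lerBlDl; apply: ge_sup; first exact: hA.1.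
  by move=> _ [m _ <-].
Qed.

(** Real and imaginary parts are treated separately, which costs the factor 2. *)
Lemma cplx_tail_limit (v : nat -> Cplx R) (e : nat -> R) :
  (forall n m, (n <= m)%N -> cabs (v m - v n) <= e n) ->
  exists l, forall n, cabs (l - v n) <= 2 * e n.
Proof.
move=> h.
have [|a ha] := @real_tail_limit (fun n => complex.Re (v n : R[i])) e.
  move=> n m nm; apply: le_trans (h n m nm).
  by apply: le_trans (Re_le_cabs _); case: (v m) (v n) => ? ? [].
have [|b hb] := @real_tail_limit (fun n => complex.Im (v n : R[i])) e.
  move=> n m nm; apply: le_trans (h n m nm).
  by apply: le_trans (Im_le_cabs _); case: (v m) (v n) => ? ? [].
exists (Complex a b) => n; apply: le_trans (cabs_le_ReIm _) _.
rewrite mulr_natl mulr2n; apply: lerD.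
- by apply: le_trans (ha n); case: (v n).
- by apply: le_trans (hb n); case: (v n).
Qed.

Lemma geom_lt (r C e : R) : 0 <= r < 1 -> 0 < e -> exists n, r ^+ n * C < e.
Proof.
move=> /andP[r0 r1] e0.
(* The sign of [C] is arbitrary and it may be 0, so the division is by [|C| + 1]. *)
have C1 : 0 < `|C| + 1 by rewrite ltr_wpDl.
have rn : `|r| < 1 by rewrite ger0_norm.
have /cvgrPdist_lt /(_ (e / (`|C| + 1))) := cvg_expr rn.
rewrite divr_gt0// => /(_ isT) [n _ /(_ n (leqnn n))].
rewrite sub0r normrN normrX ger0_norm// ltr_pdivlMr// => h.
exists n; apply: le_lt_trans h; rewrite ler_wpM2l ?exprn_ge0//.
by apply: le_trans (ler_norm _) _; rewrite lerDl.
Qed.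

Lemma conj_continuous (X : topologicalType) (f : X -> Cplx R) : continuous f ->
  continuous (fun t => ((f t : R[i])^*)%C : Cplx R).
Proof.
move=> cf x; apply/cvg_cplxP => e e0; have := cf x => /cvg_cplxP /(_ _ e0).
apply: filterS => y; rewrite -rmorphB /=.
by rewrite /cabs; case: (f y - f x) => u v /=; rewrite sqrrN.
Qed.

(** This puts |g|^2 into every ideal containing g, as [char_eval] requires. *)
Lemma conj_mul (z : Cplx R) : ((z : R[i])^*)%C * z = ((cabs z ^+ 2)%:C)%C :> Cplx R.
Proof. by rewrite rmorphXn /= -normr_cabs sqr_normc mulrC. Qed.

Lemma circle_neq0 (z : Cplx R) : circle z -> z != 0.
Proof. by move=> z1; apply: contra_eq_neq z1 => ->; rewrite cabs0 eq_sym oner_eq0. Qed.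

(** Positive powers telescope; inversion is an isometry of the circle, which carries the bound over
    to negative powers. *)
Lemma circle_expz_dist (z w : Cplx R) k : circle z -> circle w ->
  cabs (z ^ k - w ^ k) <= `|k|%N%:R * cabs (z - w).
Proof.
move=> z1 w1.
have hn n : cabs (z ^+ n - w ^+ n) <= n%:R * cabs (z - w).
  elim: n => [|n IH]; first by rewrite !expr0 subrr cabs0 mul0r.
  have -> : z ^+ n.+1 - w ^+ n.+1 = z * (z ^+ n - w ^+ n) + (z - w) * w ^+ n.
    by rewrite !exprS; ring.
  apply: le_trans (cabsD _ _) _; rewrite !cabsM cabsX z1 w1 expr1n mulr1 mul1r.
  by rewrite -natr1 mulrDl mul1r lerD2r.
case: k => n; first exact: hn.
have inv_dist (A B : Cplx R) : circle A -> circle B ->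
    cabs (A^-1 - B^-1) = cabs (A - B).
  move=> A1 B1; have A0 := circle_neq0 A1; have B0 := circle_neq0 B1.
  have -> : A^-1 - B^-1 = (B - A) * (A^-1 * B^-1) by field; rewrite A0 B0.
  by rewrite !cabsM !cabsV A1 B1 invr1 !mulr1 cabsB.
have circleX (A : Cplx R) m : circle A -> circle (A ^+ m).
  by move=> A1; rewrite /circle /= cabsX A1 expr1n.
have e : forall A : Cplx R, A ^ (Negz n) = (A ^+ n.+1)^-1 by [].
by rewrite !e inv_dist; [exact: hn|exact: circleX|exact: circleX].
Qed.

(** The circle is a closed subset of the image of the square [-1,1]^2 under (a,b) -> a + ib. *)
Lemma circle_compact : compact (@circle R).
Proof.
pose g (p : R * R) : Cplx R := (p.1%:C)%C + ('i)%C * (p.2%:C)%C.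
have cRe : continuous (fun p : R * R => (p.1%:C)%C : Cplx R).
  by move=> p; apply: (@continuous_RtoC _ (fun p : R * R => p.1)); exact: cvg_fst.
have cIm : continuous (fun p : R * R => (p.2%:C)%C : Cplx R).
  by move=> p; apply: (@continuous_RtoC _ (fun p : R * R => p.2)); exact: cvg_snd.
have cg : continuous g.
  move=> p; apply: cvgD; first exact: cRe.
  by apply: cvgM; [exact: cvg_cst|exact: cIm].
have K : compact (g @` (`[(-1 : R), 1] `*` `[(-1 : R), 1])).
  apply: continuous_compact; first exact: continuous_subspaceT.
  by apply: compact_setX; exact: segment_compact.
apply: (subclosed_compact _ K).
  rewrite (_ : @circle R = (@cabs R) @^-1` [set 1])//.
  apply: closed_comp; last exact/accessible_closed_set1/hausdorff_accessible/norm_hausdorff.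
  move=> z _; apply: (@continuous_cabs (Cplx R) id); exact: cvg_id.
move=> z z1; exists (complex.Re (z : R[i]), complex.Im (z : R[i])).
  have := Re_le_cabs z; have := Im_le_cabs z; rewrite (z1 : cabs z = 1) !ler_norml.
  by move=> h1 h2; split; rewrite /= in_itv.
by rewrite /g /= -complexE.
Qed.

End CplxNorm.

(** * Sums of nonnegative weights over the integers *)

Section WeightedSums.
Variable R : realType.
Implicit Types w : int -> R.

Definition wsum w : \bar R := (\esum_(k in [set: int]) (w k)%:E)%E.

(** Here n and -(n+1) share the rank n, in step with the two halves of [sumZ]: the N-th partial sums
    use exactly the integers of rank below N. *)
Definition zrank (k : int) : nat := match k with Posz n => n | Negz n => n end.

Definition wtail w (N : nat) : \bar R :=
  (\esum_(k in [set k | (N <= zrank k)%N]) (w k)%:E)%E.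

Lemma wsum_ge0 w : (forall k, 0 <= w k) -> (0 <= wsum w)%E.
Proof. by move=> w0; apply: esum_ge0 => k _; rewrite lee_fin. Qed.

Lemma wsum_fin w : (forall k, 0 <= w k) -> (wsum w < +oo)%E ->
  wsum w = (fine (wsum w))%:E.
Proof. by move=> w0 h; rewrite fineK// ge0_fin_numE// wsum_ge0. Qed.

Lemma le_wsum w w' : (forall k, w k <= w' k) -> (wsum w <= wsum w')%E.
Proof. by move=> h; apply: le_esum => k _; rewrite lee_fin. Qed.

Lemma wsumD w w' : (forall k, 0 <= w k) -> (forall k, 0 <= w' k) ->
  wsum (fun k => w k + w' k) = (wsum w + wsum w')%E.
Proof.
move=> h h'; rewrite /wsum -esumD//; try by move=> k _; rewrite lee_fin.
Qed.

Lemma esum_scale_le (D : set int) (r : R) (f : int -> \bar R) : 0 <= r ->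
  (forall k, 0 <= f k)%E ->
  (\esum_(k in D) (r%:E * f k) <= r%:E * \esum_(k in D) f k)%E.
Proof.
move=> r0 f0; apply: ge_ereal_sup => _ [A [finA AD] <-].
rewrite -ge0_mule_fsumr//; apply: lee_wpmul2l; first by rewrite lee_fin.
by apply: esum_ge; exists A.
Qed.

Lemma wsum_scale_le (r : R) w : 0 <= r -> (forall k, 0 <= w k) ->
  (wsum (fun k => r * w k)%R <= r%:E * wsum w)%E.
Proof.
move=> r0 w0; rewrite /wsum; under eq_esum do rewrite EFinM.
by apply: esum_scale_le => // k; rewrite lee_fin.
Qed.

Lemma exchange_esum (f : int -> int -> \bar R) : (forall i j, 0 <= f i j)%E ->
  (\esum_(i in [set: int]) \esum_(j in [set: int]) f i j =
   \esum_(j in [set: int]) \esum_(i in [set: int]) f i j)%E.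
Proof.
move=> f0; rewrite !esum_esum//.
rewrite (@reindex_esum R _ _ ([set: int] `*`` (fun=> [set: int]))
  ([set: int] `*`` (fun=> [set: int])) (fun p : int * int => (p.2, p.1)))//.
split=> //; first by move=> [a b] [c d] _ _ /= [-> ->].
by move=> [a b] _; exists (b, a).
Qed.

Lemma wsum_shift w (n : int) : wsum (fun k => w (k - n)) = wsum w.
Proof.
rewrite /wsum [RHS](@reindex_esum R _ _ [set: int] [set: int] (fun k => k - n))//.
split=> //; first by move=> a b _ _ /addIr.
by move=> a _; exists (a + n) => //; rewrite addrK.
Qed.

(** After exchanging the sums, the inner one is w(k) times a translate of w'. Finiteness of its sum
    makes it a real scalar that can be pulled out. *)
Lemma wsum_conv_le w w' : (forall k, 0 <= w k) -> (forall k, 0 <= w' k) ->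
  (wsum w' < +oo)%E ->
  (\esum_(n in [set: int]) wsum (fun k => (w k * w' (n - k))%R) <=
   wsum w' * wsum w)%E.
Proof.
move=> w0 w'0 fin'.
rewrite exchange_esum; last by move=> i j; rewrite lee_fin mulr_ge0.
rewrite (wsum_fin w'0 fin').
apply: (@le_trans _ _ (\esum_(k in [set: int]) ((fine (wsum w'))%:E * (w k)%:E))%E).
  apply: le_esum => k _.
  apply: le_trans (@wsum_scale_le (w k) (fun n => w' (n - k)) (w0 k) _) _ => //.
  by rewrite wsum_shift muleC -wsum_fin.
apply: esum_scale_le; first exact/fine_ge0/wsum_ge0.
by move=> k; rewrite lee_fin.
Qed.

Lemma le_term_wsum w k : (forall j, 0 <= w j) -> ((w k)%:E <= wsum w)%E.
Proof.
move=> w0; apply: esum_ge; exists [set k]; first by split; [exact: finite_set1|].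
by rewrite fsbig_set1.
Qed.

Lemma esum_ge_seq (D : set int) (s : seq int) w : uniq s ->
  (forall k, k \in s -> D k) ->
  ((\sum_(k <- s) w k)%:E <= \esum_(k in D) (w k)%:E)%E.
Proof.
move=> us sD; apply: esum_ge; exists [set` s].
  by split; [exact: finite_seq|move=> k /= /sD].
by rewrite -fsbig_seq// sumEFin lexx.
Qed.

Lemma wtail_small w : (forall k, 0 <= w k) -> (wsum w < +oo)%E ->
  forall e : R, 0 < e -> exists N, forall M, (N <= M)%N -> (wtail w M < e%:E)%E.
Proof.
move=> w0 wfin e e0.
have wE := wsum_fin w0 wfin.
have fw : (wsum w \is a fin_num) by rewrite wE.
have [_ [A [finA _] <-] hA] := ub_ereal_sup_adherent e0 fw.
have {}hA : (wsum w - e%:E < \sum_(i \in A) (w i)%:E)%E := hA.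
have /finite_seqP [s sA] := finA.
(* [A] is a finite set carrying all but e of the total. Beyond all its ranks the tail is disjoint
   from [A], hence smaller than e. *)
exists (\max_(k <- s) (zrank k).+1)%N => M sM.
have := @esumID R _ [set k | (M <= zrank k)%N] [set: int] (fun k => (w k)%:E).
rewrite !setTI => wID.
have {}wID : wsum w = (wtail w M + \esum_(k in ~` [set k | (M <= zrank k)%N]) (w k)%:E)%E.
  by apply: wID => k _; rewrite lee_fin.
have hA2 : (\sum_(i \in A) (w i)%:E <=
    \esum_(k in ~` [set k | (M <= zrank k)%N]) (w k)%:E)%E.
  apply: esum_ge; exists A => //; split=> // k; rewrite sA /= => ks.
  apply/negP; rewrite -ltnNge; apply: leq_trans sM.
  exact: (@leq_bigmax_seq _ s xpredT (fun k => (zrank k).+1)).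
have t0 : (0 <= wtail w M)%E by apply: esum_ge0 => k _; rewrite lee_fin.
move: hA hA2; rewrite wID.
have : (wtail w M + \esum_(k in ~` [set k | (M <= zrank k)%N]) (w k)%:E < +oo)%E.
  by rewrite -wID.
have q0 : (0 <= \esum_(k in ~` [set k | (M <= zrank k)%N]) (w k)%:E)%E.
  by apply: esum_ge0 => k _; rewrite lee_fin.
case: (wtail w M) t0 => [t| |]//; case: (\esum_(k in ~` _) _) q0 => [q| |]// _ _ _.
by move=> h1 h2; move: (lt_le_trans h1 h2); rewrite -EFinD !lte_fin; lra.
Qed.

End WeightedSums.

(** * Absolutely summable families over the integers *)

Section SumZ.
Variable R : realType.
Implicit Types u v : int -> Cplx R.

Definition l1norm u : \bar R := wsum (fun k => cabs (u k)).

Definition psumZ u (N : nat) : Cplx R :=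
  \sum_(0 <= k < N) u (Posz k) + \sum_(0 <= k < N) u (Negz k).

Definition deltaZ (k : int) (c : Cplx R) : int -> Cplx R :=
  fun j => if j == k then c else 0.

Definition truncZ (N : nat) u : int -> Cplx R :=
  fun k => if (zrank k < N)%N then u k else 0.

Lemma l1norm_fin u : (l1norm u < +oo)%E -> l1norm u = (fine (l1norm u))%:E.
Proof. by apply: wsum_fin => k; exact: cabs_ge0. Qed.

Lemma psumZ_le u N : ((cabs (psumZ u N))%:E <= l1norm u)%E.
Proof.
pose s := map Posz (index_iota 0 N) ++ map Negz (index_iota 0 N).
have -> : psumZ u N = \sum_(k <- s) u k by rewrite big_cat !big_map.
apply: le_trans (@esum_ge_seq R [set: int] s _ _ _) => //.
  by rewrite lee_fin; exact: cabs_sum.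
rewrite cat_uniq !map_inj_uniq ?iota_uniq; try by move=> a b [].
by rewrite andbT /=; apply/hasPn => _ /mapP [n _ ->]; apply/negP => /mapP [m _].
Qed.

Lemma wtail_fin u : (l1norm u < +oo)%E -> forall N,
  wtail (fun k => cabs (u k)) N = (fine (wtail (fun k => cabs (u k)) N))%:E.
Proof.
move=> fu N; rewrite fineK// ge0_fin_numE; last first.
  by apply: esum_ge0 => k _; rewrite lee_fin cabs_ge0.
apply: le_lt_trans fu; rewrite /wtail esum_mkcond; apply: le_esum => k _.
by case: ifP => // _; rewrite lee_fin cabs_ge0.
Qed.

(** Used with [c] equal to [Posz] and to [Negz]; the tails of the norm serve as an explicit Cauchy
    modulus. *)
Lemma half_sum_cvg u (c : nat -> int) : injective c -> (forall n, zrank (c n) = n) ->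
  (l1norm u < +oo)%E ->
  cvgn (fun N => \sum_(0 <= k < N) u (c k)).
Proof.
move=> ci cr fu.
pose t N := fine (wtail (fun k => cabs (u k)) N).
have [|l hl] := @cplx_tail_limit R (fun N => \sum_(0 <= k < N) u (c k)) t.
  move=> n m nm.
  rewrite (big_cat_nat (leq0n n) nm)//= addrAC subrr add0r.
  apply: le_trans (cabs_sum _ _ _) _; rewrite -lee_fin -wtail_fin//.
  rewrite -(big_map c xpredT (fun k => cabs (u k))).
  apply: esum_ge_seq; first by rewrite map_inj_uniq// iota_uniq.
  by move=> _ /mapP [i + ->]; rewrite mem_index_iota /= cr => /andP[].
apply/cvg_ex; exists l; apply/cvg_cplxP => e e0.
have [||N hN] := @wtail_small R (fun k => cabs (u k)) _ fu (e / 2).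
- by move=> k; exact: cabs_ge0.
- by rewrite divr_gt0.
exists N => // M /= /hN; rewrite wtail_fin// lte_fin => h.
rewrite cabsB; apply: le_lt_trans (hl M) _.
by rewrite mulrC -ltr_pdivlMr.
Qed.

Lemma sumZ_cvg u : (l1norm u < +oo)%E -> psumZ u @ \oo --> sumZ u.
Proof.
by move=> fu; apply: cvgD; apply: half_sum_cvg => // a b [].
Qed.

Lemma sumZ_lim u l : (l1norm u < +oo)%E -> psumZ u @ \oo --> l -> sumZ u = l.
Proof. by move=> /sumZ_cvg h1 h2; exact: cvg_unique h1 h2. Qed.

Lemma sumZ_le u : (l1norm u < +oo)%E -> ((cabs (sumZ u))%:E <= l1norm u)%E.
Proof.
move=> fu; rewrite l1norm_fin// lee_fin; apply/ler_addgt0Pr => e e0.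
have /cvg_cplxP /(_ _ e0) [N _ /(_ N (leqnn N)) h] := sumZ_cvg fu.
rewrite -[sumZ u](subrK (psumZ u N)) addrC.
apply: le_trans (cabsD _ _) _; apply: lerD; last by rewrite cabsB ltW.
by rewrite -lee_fin -l1norm_fin// psumZ_le.
Qed.

Lemma l1normD u v : (l1norm (fun k => (u k + v k)%R) <= l1norm u + l1norm v)%E.
Proof.
rewrite -wsumD; try by move=> k; exact: cabs_ge0.
by apply: le_wsum => k; exact: cabsD.
Qed.

Lemma l1norm_le u v : (forall k, cabs (u k) <= cabs (v k)) ->
  (l1norm u <= l1norm v)%E.
Proof. exact: le_wsum. Qed.

Lemma l1normD_fin u v : (l1norm u < +oo)%E -> (l1norm v < +oo)%E ->
  (l1norm (fun k => (u k + v k)%R) < +oo)%E.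
Proof. by move=> fu fv; apply: le_lt_trans (l1normD u v) _; exact: lte_add_pinfty. Qed.

Lemma l1normZ (c : Cplx R) u : (l1norm (fun k => (c * u k)%R) <= (cabs c)%:E * l1norm u)%E.
Proof.
apply: le_trans (wsum_scale_le (cabs_ge0 c) (fun k => cabs_ge0 (u k))).
by apply: le_wsum => k; rewrite cabsM.
Qed.

Lemma l1normZ_fin (c : Cplx R) u : (l1norm u < +oo)%E ->
  (l1norm (fun k => (c * u k)%R) < +oo)%E.
Proof.
move=> fu; apply: le_lt_trans (l1normZ c u) _.
by rewrite (l1norm_fin fu) -EFinM ltry.
Qed.

Lemma sumZD u v : (l1norm u < +oo)%E -> (l1norm v < +oo)%E ->
  sumZ (fun k => u k + v k) = sumZ u + sumZ v.
Proof.
move=> fu fv; apply: sumZ_lim; first exact: l1normD_fin.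
have -> : psumZ (fun k => u k + v k) = (fun N => psumZ u N + psumZ v N).
  by apply/funext => N; rewrite /psumZ !big_split /= addrACA.
by apply: cvgD; exact: sumZ_cvg.
Qed.

Lemma sumZM (c : Cplx R) u : (l1norm u < +oo)%E ->
  sumZ (fun k => c * u k) = c * sumZ u.
Proof.
move=> fu; apply: sumZ_lim; first exact: l1normZ_fin.
have -> : psumZ (fun k => c * u k) = (fun N => c * psumZ u N).
  by apply/funext => N; rewrite /psumZ -!mulr_sumr mulrDr.
by apply: cvgM; [exact: cvg_cst|exact: sumZ_cvg].
Qed.

Lemma truncZS N u : truncZ N.+1 u = (fun k => truncZ N u k +
  (deltaZ (Posz N) (u (Posz N)) k + deltaZ (Negz N) (u (Negz N)) k)).
Proof.
apply/funext => k; rewrite /truncZ /deltaZ ltnS leq_eqVlt.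
case: k => n /=; [rewrite eqz_nat addr0|rewrite add0r].
  by case: (eqVneq n N) => [->|_] /=; rewrite ?ltnn ?add0r ?addr0.
have -> : (Negz n == Negz N) = (n == N) by apply/eqP/eqP => [[]|->].
by case: (eqVneq n N) => [->|_] /=; rewrite ?ltnn ?add0r ?addr0.
Qed.

Lemma l1norm_delta k c : (l1norm (deltaZ k c) <= (cabs c)%:E)%E.
Proof.
rewrite /l1norm /wsum.
rewrite (_ : (\esum_(_ in _) _)%E = \esum_(j in [set k]) (cabs c)%:E).
  by rewrite esum_set1// lee_fin cabs_ge0.
rewrite [RHS]esum_mkcond; apply: eq_esum => j _; rewrite /deltaZ.
rewrite (_ : (j \in [set k]) = (j == k)); first by case: ifP => // _; rewrite cabs0.
by apply/idP/eqP; rewrite inE.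
Qed.

Lemma l1norm_delta_fin k c : (l1norm (deltaZ k c) < +oo)%E.
Proof. by apply: le_lt_trans (l1norm_delta k c) _; rewrite ltry. Qed.

Lemma l1norm_trunc_fin N u : (l1norm u < +oo)%E -> (l1norm (truncZ N u) < +oo)%E.
Proof.
apply: le_lt_trans; apply: l1norm_le => k; rewrite /truncZ.
by case: ifP => // _; rewrite cabs0 cabs_ge0.
Qed.

Lemma l1norm_tail N u :
  l1norm (fun k => u k - truncZ N u k) = wtail (fun k => cabs (u k)) N.
Proof.
rewrite /wtail esum_mkcond; apply: eq_esum => k _; rewrite /truncZ.
have -> : (k \in [set k | (N <= zrank k)%N]) = (N <= zrank k)%N.
  by apply/idP/idP; rewrite inE.
by case: leqP => _; rewrite ?subr0// subrr cabs0.
Qed.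

(* Finitely supported families are dense in l^1(Z). *)
Lemma l1_functional_eq0 (L : (int -> Cplx R) -> Cplx R) (C : R) : 0 <= C ->
  (forall u v, (l1norm u < +oo)%E -> (l1norm v < +oo)%E ->
     L (fun k => u k + v k) = L u + L v) ->
  (forall u, (l1norm u < +oo)%E -> ((cabs (L u))%:E <= C%:E * l1norm u)%E) ->
  (forall k c, L (deltaZ k c) = 0) ->
  forall u, (l1norm u < +oo)%E -> L u = 0.
Proof.
move=> C0 LD Lb Ld u fu.
have Lt N : L (truncZ N u) = 0.
  elim: N => [|N IH].
    rewrite (_ : truncZ 0 u = deltaZ 0 0)//.
    by apply/funext => k; rewrite /truncZ /deltaZ; case: ifP.
  rewrite truncZS LD; last exact/l1normD_fin/l1norm_delta_fin/l1norm_delta_fin.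
    by rewrite LD ?IH ?Ld ?addr0//; exact: l1norm_delta_fin.
  exact: l1norm_trunc_fin.
apply: cabs_eq0; apply/le_anti; rewrite cabs_ge0 andbT.
apply/ler_addgt0Pr => e e0; rewrite add0r.
have C1 : 0 < C + 1 by rewrite ltr_wpDl.
have [||N /(_ _ (leqnn N)) hN] := @wtail_small R (fun k => cabs (u k)) _ fu (e / (C + 1)).
- by move=> k; exact: cabs_ge0.
- by rewrite divr_gt0.
have fN : (l1norm (fun k => (u k - truncZ N u k)%R) < +oo)%E.
  by rewrite l1norm_tail (lt_trans hN)// ltry.
have -> : u = (fun k => truncZ N u k + (u k - truncZ N u k)).
  by apply/funext => k; rewrite addrC subrK.
rewrite LD//; last exact: l1norm_trunc_fin.
rewrite Lt add0r -lee_fin; apply: le_trans (Lb _ fN) _.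
rewrite l1norm_tail; move: hN; rewrite wtail_fin// lte_fin -EFinM lee_fin.
rewrite ltr_pdivlMr// => /ltW; apply: le_trans.
rewrite mulrC ler_wpM2l//; last by rewrite lerDl.
by apply: fine_ge0; apply: esum_ge0 => k _; rewrite lee_fin cabs_ge0.
Qed.

Lemma psumZ_delta k c N : (zrank k < N)%N -> psumZ (deltaZ k c) N = c.
Proof.
move=> kN; rewrite /psumZ /deltaZ !big_mkord.
case: k kN => n /= nN.
- rewrite (bigD1 (Ordinal nN))//= eqxx big1; last first.
    by move=> i; rewrite -val_eqE /= eqz_nat => /negPf ->.
  by rewrite addr0 big1 ?addr0.
- rewrite addrC (bigD1 (Ordinal nN))//= eqxx big1; last first.
    move=> i; rewrite -val_eqE /= => ni.
    by rewrite (_ : (Negz i == Negz n) = false)//; apply/eqP => -[]; apply/eqP.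
  by rewrite addr0 big1 ?addr0.
Qed.

Lemma sumZ_delta k c : sumZ (deltaZ k c) = c.
Proof.
apply: sumZ_lim; first exact: l1norm_delta_fin.
apply/cvg_cplxP => e e0; exists (zrank k).+1 => // N /= kN.
by rewrite psumZ_delta// subrr cabs0.
Qed.

Lemma sumZN u : (l1norm u < +oo)%E -> sumZ (fun k => - u k) = - sumZ u.
Proof.
by move=> fu; rewrite -mulN1r -sumZM//; congr sumZ; apply/funext => k; rewrite mulN1r.
Qed.

Lemma l1norm_reindex_le u (h : int -> int) : injective h ->
  (l1norm (u \o h) <= l1norm u)%E.
Proof.
move=> hi; rewrite /l1norm /wsum.
rewrite -(@esum_image R _ _ [set: int] h (fun k => (cabs (u k))%:E)).
  rewrite esum_mkcond; apply: le_esum => k _.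
  by case: ifP => // _; rewrite lee_fin cabs_ge0.
by move=> a b _ _ /hi.
Qed.

Lemma sumZ_reindex u (h : int -> int) : injective h ->
  (forall k, u k != 0 -> exists j, h j = k) -> (l1norm u < +oo)%E ->
  sumZ (u \o h) = sumZ u.
Proof.
move=> hi hu fu.
(* The support condition concerns the given [u] only, while the density argument needs an identity
   for all sequences. So [u] is replaced by its restriction to the range of [h], which is defined
   for every sequence. *)
pose r v k := if `[< exists j, h j = k >] then v k else 0 : Cplx R.
have rle v k : cabs (r v k) <= cabs (v k).
  by rewrite /r; case: ifP => // _; rewrite cabs0 cabs_ge0.
have rfin v : (l1norm v < +oo)%E -> (l1norm (r v) < +oo)%E.
  by apply: le_lt_trans; exact: l1norm_le.
have hfin v : (l1norm v < +oo)%E -> (l1norm (v \o h) < +oo)%E.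
  by apply: le_lt_trans; exact: l1norm_reindex_le.
have -> : sumZ u = sumZ (r u).
  congr sumZ; apply/funext => k; rewrite /r; case: asboolP => // nk.
  by apply/eqP; apply: contra_notT nk => /hu.
apply/eqP; rewrite -subr_eq0; apply/eqP.
apply: (@l1_functional_eq0 (fun v => sumZ (v \o h) - sumZ (r v)) 2) => //.
- move=> v w fv fw.
  rewrite (_ : r _ = (fun k => r v k + r w k)); last first.
    by apply/funext => k; rewrite /r; case: ifP; rewrite ?addr0.
  rewrite (sumZD (rfin _ fv) (rfin _ fw)) (sumZD (hfin _ fv) (hfin _ fw)).
  by rewrite opprD addrACA.
- move=> v fv; rewrite (l1norm_fin fv) -EFinM lee_fin.
  apply: le_trans (cabsD _ _) _; rewrite cabsN mulr_natl mulr2n.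
  apply: lerD; rewrite -lee_fin -(l1norm_fin fv).
    by apply: le_trans (sumZ_le (hfin _ fv)) _; exact: l1norm_reindex_le.
  by apply: le_trans (sumZ_le (rfin _ fv)) _; exact: l1norm_le.
- move=> k c; apply/eqP; rewrite subr_eq0; apply/eqP.
  have [[j jk]|nk] := pselect (exists j, h j = k).
    transitivity c; last first.
      rewrite -[LHS](sumZ_delta k); congr sumZ; apply/funext => i; rewrite /r /deltaZ.
      case: (eqVneq i k) => [->|_]; last by case: ifP.
      by rewrite (_ : `[< _ >])//; apply/asboolP; exists j.
    rewrite -[RHS](sumZ_delta j); congr sumZ; apply/funext => i.
    by rewrite /deltaZ /= -jk (inj_eq hi).
  congr sumZ; apply/funext => i; rewrite /r /deltaZ /=.
  rewrite (_ : (h i == k) = false); last by apply/eqP => e; apply: nk; exists i.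
  case: (eqVneq i k) => [ik|_]; last by case: ifP.
  by rewrite (_ : `[< _ >] = false)//; apply/asboolP; rewrite ik.
Qed.

Definition convZ u v (n : int) : Cplx R := sumZ (fun k => u k * v (n - k)).

Lemma l1norm_conv_term_fin u v n : (l1norm u < +oo)%E -> (l1norm v < +oo)%E ->
  (l1norm (fun k => (u k * v (n - k))%R) < +oo)%E.
Proof.
move=> fu fv; pose c := fine (l1norm v).
have cv k : cabs (v k) <= c.
  rewrite -lee_fin -l1norm_fin//.
  by apply: (@le_term_wsum _ (fun k => cabs (v k))) => j; exact: cabs_ge0.
have c0 : 0 <= c by apply: le_trans (cv 0); exact: cabs_ge0.
apply: (@le_lt_trans _ _ (wsum (fun k => c * cabs (u k))%R)).
  by apply: le_wsum => k; rewrite cabsM mulrC ler_wpM2r ?cabs_ge0.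
apply: le_lt_trans (wsum_scale_le c0 (fun k => cabs_ge0 (u k))) _.
by rewrite -/(l1norm u) (l1norm_fin fu) -EFinM ltry.
Qed.

Lemma l1norm_conv u v : (l1norm u < +oo)%E -> (l1norm v < +oo)%E ->
  (l1norm (convZ u v) <= l1norm v * l1norm u)%E.
Proof.
move=> fu fv.
apply: le_trans (wsum_conv_le (fun k => cabs_ge0 (u k)) (fun k => cabs_ge0 (v k)) fv).
apply: le_esum => n _.
apply: le_trans (sumZ_le (l1norm_conv_term_fin n fu fv)) _.
by apply: le_wsum => k; rewrite cabsM.
Qed.

Lemma l1norm_conv_fin u v : (l1norm u < +oo)%E -> (l1norm v < +oo)%E ->
  (l1norm (convZ u v) < +oo)%E.
Proof.
move=> fu fv; apply: le_lt_trans (l1norm_conv fu fv) _.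
by rewrite (l1norm_fin fu) (l1norm_fin fv) -EFinM ltry.
Qed.

(** Both sides are additive and bounded in [u], so [u] may be taken to be a one-point sequence; the
    identity is then translation invariance of the sum of [v]. *)
Lemma sumZ_conv u v : (l1norm u < +oo)%E -> (l1norm v < +oo)%E ->
  sumZ (convZ u v) = sumZ u * sumZ v.
Proof.
move=> fu fv; apply/eqP; rewrite -subr_eq0; apply/eqP.
have v0 : 0 <= fine (l1norm v) by apply: fine_ge0; apply: wsum_ge0 => k; exact: cabs_ge0.
apply: (@l1_functional_eq0 (fun u => sumZ (convZ u v) - sumZ u * sumZ v)
  (2 * fine (l1norm v))) => //.
- by rewrite mulr_ge0.
- move=> u1 u2 f1 f2; rewrite (sumZD f1 f2) mulrDl.
  rewrite (_ : convZ _ _ = (fun n => convZ u1 v n + convZ u2 v n)); last first.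
    apply/funext => n; rewrite /convZ -sumZD; try exact: l1norm_conv_term_fin.
    by congr sumZ; apply/funext => k; rewrite mulrDl.
  by rewrite (sumZD (l1norm_conv_fin f1 fv) (l1norm_conv_fin f2 fv)) opprD addrACA.
- move=> w fw; rewrite (l1norm_fin fw) -EFinM lee_fin.
  apply: le_trans (cabsD _ _) _; rewrite cabsN -mulrA mulr_natl mulr2n.
  apply: lerD.
    rewrite -lee_fin EFinM -!l1norm_fin//.
    by apply: le_trans (sumZ_le (l1norm_conv_fin fw fv)) _; exact: l1norm_conv.
  rewrite cabsM mulrC; apply: ler_pM; rewrite ?cabs_ge0//.
    by rewrite -lee_fin -l1norm_fin// sumZ_le.
  by rewrite -lee_fin -l1norm_fin// sumZ_le.
- move=> k c; rewrite sumZ_delta.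
  have -> : convZ (deltaZ k c) v = (fun n => c * (v \o (fun n => n - k)) n).
    apply/funext => n; rewrite /convZ -[RHS](sumZ_delta k); congr sumZ.
    apply/funext => j; rewrite /deltaZ; case: eqP => [->//|_].
    by rewrite mul0r.
  have ki : injective (fun n : int => n - k) by move=> a b /addIr.
  rewrite sumZM; last by apply: le_lt_trans fv; exact: l1norm_reindex_le.
  rewrite sumZ_reindex ?subrr// => j _.
  by exists (j + k); rewrite addrK.
Qed.

End SumZ.

(** * Truncation, dominated convergence and a Fatou-type bound for sums over the integers *)

Section SumZLimit.
Variable R : realType.

Lemma sumZ_trunc (u : int -> Cplx R) N : (l1norm u < +oo)%E ->
  sumZ (truncZ N u) = psumZ u N.
Proof.
move=> fu; elim: N => [|N IH].
  rewrite (_ : truncZ 0 u = deltaZ 0 0) ?sumZ_delta /psumZ ?big_nil ?addr0//.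
  by apply/funext => k; rewrite /truncZ /deltaZ; case: ifP.
have fd := fun k => @l1norm_delta_fin R k.
rewrite truncZS sumZD; last exact: l1normD_fin.
  by rewrite sumZD// !sumZ_delta IH /psumZ !big_nat_recr//= addrACA.
exact: l1norm_trunc_fin.
Qed.

Lemma sumZ_psumZ_dist (u : int -> Cplx R) N : (l1norm u < +oo)%E ->
  ((cabs (sumZ u - psumZ u N))%:E <= wtail (fun k => cabs (u k)) N)%E.
Proof.
move=> fu; have ft := l1norm_trunc_fin N fu.
have fd : (l1norm (fun k => (u k - truncZ N u k)%R) < +oo)%E.
  by rewrite l1norm_tail wtail_fin// ltry.
rewrite -sumZ_trunc// -l1norm_tail; apply: le_trans (sumZ_le fd).
rewrite (_ : sumZ u = sumZ (fun k => truncZ N u k + (u k - truncZ N u k))).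
  by rewrite sumZD// [_ + sumZ _]addrC addrK.
by congr sumZ; apply/funext => k; rewrite addrC subrK.
Qed.

Lemma cvg_sum_nat (T : Type) (G : set_system T) (FG : Filter G)
    (f : nat -> T -> Cplx R) (l : nat -> Cplx R) N :
  (forall k, f k @ G --> l k) ->
  (fun t => \sum_(0 <= k < N) f k t) @ G --> \sum_(0 <= k < N) l k.
Proof.
move=> fl; elim: N => [|N IH].
  rewrite big_nil (_ : (fun t => _) = cst 0); first exact: cvg_cst.
  by apply/funext => t; rewrite big_nil.
have -> : (fun t => \sum_(0 <= k < N.+1) f k t) =
    (fun t => \sum_(0 <= k < N) f k t + f N t).
  by apply/funext => t; rewrite big_nat_recr.
have -> : \sum_(0 <= k < N.+1) l k = \sum_(0 <= k < N) l k + l N.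
  by rewrite big_nat_recr.
by apply: cvgD; [exact: IH|exact: fl].
Qed.

(** One rank N makes the tails of all dominated sums less than e/3, leaving a finite sum. The
    domination of [F] is asked only eventually along [G], because for psi it holds only on the
    circle. *)
Lemma sumZ_dominated_cvg (T : Type) (G : set_system T) (FG : Filter G)
    (F : int -> T -> Cplx R) (l : int -> Cplx R) (w : int -> R) :
  (wsum w < +oo)%E ->
  (forall k, F k @ G --> l k) ->
  (\forall t \near G, forall k, cabs (F k t) <= w k) ->
  (forall k, cabs (l k) <= w k) ->
  (fun t => sumZ (fun k => F k t)) @ G --> sumZ l.
Proof.
move=> fw Fl Fw lw; apply/cvg_cplxP => e e0.
have w0 k : 0 <= w k by apply: le_trans (lw k); exact: cabs_ge0.
have e3 : 0 < e / 3 by rewrite divr_gt0.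
have [N /(_ _ (leqnn N)) hN] := wtail_small w0 fw e3.
have dist u : (forall k, cabs (u k) <= w k) -> cabs (sumZ u - psumZ u N) < e / 3.
  move=> uw; have fu : (l1norm u < +oo)%E by apply: le_lt_trans fw; exact: le_wsum.
  rewrite -lte_fin; apply: le_lt_trans hN.
  apply: le_trans (sumZ_psumZ_dist N fu) _.
  by apply: le_esum => k _; rewrite lee_fin.
have : (fun t => psumZ (fun k => F k t) N) @ G --> psumZ l N.
  by rewrite /psumZ; apply: cvgD; exact: cvg_sum_nat.
move=> /cvg_cplxP /(_ _ e3); apply: filterS2 Fw => t /dist d1 d2.
apply: le_lt_trans (cabs_dist _ (psumZ (fun k => F k t) N) _) _.
apply: le_lt_trans (lerD (lexx _) (cabs_dist _ (psumZ l N) _)) _.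
have := dist l lw; rewrite cabsB => d3; lra.
Qed.

(** A Fatou argument: on a finite set of indices, n is chosen so late that the errors [e n] add up
    to at most 1, so every finite sum of [w] is at most C + 1. *)
Lemma wsum_le_limit (w : int -> R) (wn : nat -> int -> R) (e : nat -> R) (C : R) :
  (forall n k, 0 <= wn n k) -> (forall n, wsum (wn n) <= C%:E)%E ->
  (forall n k, w k <= wn n k + e n) -> e @ \oo --> (0 : R) -> (wsum w < +oo)%E.
Proof.
move=> wn0 wnC we /cvgrPdist_lt e0.
apply: (@le_lt_trans _ _ (C + 1)%:E); last by rewrite ltry.
apply: ge_ereal_sup => _ [A [finA _] <-].
have /finite_seqP [s0 As0] := finA.
pose s := undup s0.
have -> : A = [set` s] by rewrite As0; apply/seteqP; split=> k /=; rewrite mem_undup.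
rewrite -fsbig_seq ?undup_uniq// sumEFin lee_fin.
have s1 : 0 < (size s).+1%:R^-1 :> R by rewrite invr_gt0.
have [n _ /(_ n (leqnn n))] := e0 _ s1.
rewrite sub0r normrN => /ltW en.
apply: le_trans (ler_sum _ (fun k _ => we n k)) _.
rewrite big_split /=; apply: lerD.
  rewrite -lee_fin; apply: le_trans (wnC n).
  by apply: esum_ge_seq; rewrite ?undup_uniq.
rewrite big_const_seq count_predT iter_addr_0 -mulr_natr.
apply: (@le_trans _ _ ((size s).+1%:R^-1 * (size s)%:R)).
  by rewrite ler_wpM2r// (le_trans (ler_norm _)).
by rewrite ler_pdivrMl// mulr1 ler_nat.
Qed.

End SumZLimit.

(** * Integer powers of the homeomorphism and their fixed-point sets *)

Section Iterates.
Variables (X : topologicalType) (sigma sigmai : X -> X).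
Hypotheses (sK : cancel sigma sigmai) (siK : cancel sigmai sigma).

Local Notation iterz := (iterz sigma sigmai).
Local Notation Fix := (Fix sigma sigmai).

Lemma iterz_succ k x : iterz (k + 1) x = sigma (iterz k x).
Proof.
case: k => n; first by rewrite -PoszD addn1.
case: n => [|n]; first by rewrite /= siK.
by rewrite (_ : Negz n.+1 + 1 = Negz n) /= ?siK// !NegzE; lia.
Qed.

Lemma iterz_pred k x : iterz (k - 1) x = sigmai (iterz k x).
Proof. by rewrite -[in RHS](subrK 1 k) iterz_succ sK. Qed.

Lemma iterzD j k x : iterz (j + k) x = iterz j (iterz k x).
Proof.
elim/int_rect: j => [|n IH|n IH]; first by rewrite add0r.
  by rewrite -addn1 PoszD addrAC iterz_succ IH -iterz_succ.
by rewrite -addn1 PoszD opprD addrAC iterz_pred IH -iterz_pred.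
Qed.

Lemma FixD j k x : Fix j x -> Fix k x -> Fix (j + k) x.
Proof. by rewrite /Defs.Fix /= iterzD => + ->. Qed.

Lemma FixN k x : Fix k x -> Fix (- k) x.
Proof. by rewrite /Defs.Fix /= => {1}<-; rewrite -iterzD addNr. Qed.

Lemma Fix_interiorD j k x : interior (Fix j) x -> interior (Fix k) x ->
  interior (Fix (j + k)) x.
Proof. by apply: filterS2 => y; exact: FixD. Qed.

Lemma Fix_interiorN k x : interior (Fix k) x -> interior (Fix (- k)) x.
Proof. by apply: filterS => y; exact: FixN. Qed.

Lemma Fix_interior_mul k m x : interior (Fix k) x -> interior (Fix (m * k)) x.
Proof.
move=> h; elim/int_rect: m => [|n IH|n IH].
- by rewrite mul0r; apply: filterS h.
- by rewrite -addn1 PoszD mulrDl mul1r; exact: Fix_interiorD.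
- by rewrite -addn1 PoszD opprD mulrDl mulN1r; apply/Fix_interiorD/Fix_interiorN.
Qed.

(* The k with x in the interior of Fix_k form a subgroup of Z. *)
Lemma Fix_interior_dvd (n : nat) k x : (0 < n)%N -> interior (Fix n%:Z) x ->
  (forall m : nat, (0 < m < n)%N -> ~ interior (Fix m%:Z) x) ->
  interior (Fix k) x -> exists j, k = j * n%:Z.
Proof.
move=> n0 hn nmin hk; exists (k %/ n)%Z.
rewrite {1}(divz_eq k n).
suff -> : (k %% n)%Z = 0 by rewrite addr0.
have kr : interior (Fix (k %% n)%Z) x.
  rewrite (_ : (k %% n)%Z = k + - (k %/ n)%Z * n).
    by apply/Fix_interiorD/Fix_interior_mul.
  by rewrite {2}(divz_eq k n) mulNr addrAC subrr add0r.
have : (0 <= (k %% n)%Z < n) by rewrite modz_ge0 ?ltz_pmod//; lia.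
case: (k %% n)%Z kr => // m hm mn.
have [->//|m0] := posnP m.
by have := nmin m; rewrite m0 /= => /(_ mn).
Qed.

Hypotheses (cs : continuous sigma) (csi : continuous sigmai).

Lemma iterz_continuous k : continuous (iterz k).
Proof.
have it (f : X -> X) n : continuous f -> continuous (iter n f).
  move=> cf; elim: n => [|n IH] x; first exact: cvg_id.
  by apply: (@continuous_comp _ _ _ (iter n f) f); [exact: IH|exact: cf].
by case: k => n; exact: it.
Qed.

(** Neighbourhoods of sigma^k p and of p always meet when p is in the closure: a fixed point x near
    p lies in both, as sigma^k x = x. *)
Lemma Fix_closed k : hausdorff_space X -> closed (Fix k).
Proof.
move=> hX p hp; apply: hX => A B hA hB.
have : nbhs p (iterz k @^-1` A `&` B).
  by apply: filterI => //; exact: iterz_continuous hA.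
by move=> /hp [x [fx [/= Ax Bx]]]; exists x; split=> //; rewrite -fx.
Qed.

End Iterates.

(** * The algebra C(X)'_1 *)

Section Families.
Variables (R : realType) (X : topologicalType) (sigma sigmai : X -> X).
Hypotheses (cX : compact [set: X]) (hX : hausdorff_space X) (x0 : X).
Hypotheses (cs : continuous sigma) (csi : continuous sigmai).
Hypotheses (sK : cancel sigma sigmai) (siK : cancel sigmai sigma).

Local Notation Fix := (Fix sigma sigmai).
Local Notation in_comm := (@in_comm R X sigma sigmai).
Local Notation l1mul := (@l1mul R X sigma sigmai).
Implicit Types a b : int -> X -> Cplx R.

Lemma urysohn_point (x : X) (U : set X) : nbhs x U ->
  exists u : X -> R, [/\ continuous u, forall y, 0 <= u y <= 1, u x = 1
    & forall y, u y != 0 -> U y].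
Proof.
move=> xU; have nX := compact_normal hX cX.
have xc : closed [set x] by apply/accessible_closed_set1/hausdorff_accessible.
have Uc : closed (~` U°) by apply: open_closedC; exact: open_interior.
have [|u [cu u0 u1 u01]] := urysohn_ext_itv nX Uc xc _ (@ltr01 R).
  by apply/seteqP; split=> // y [nU yx]; apply: nU; rewrite yx.
exists u; split=> //.
- by move=> y; have /= := u01 (u y); rewrite in_itv /=; apply; exists y.
- by apply: u1; exists x.
- move=> y; apply: contra_neqP => nU; apply: u0; exists y => //.
  by move=> /interior_subset.
Qed.

Lemma separating_function (x y : X) : y <> x ->
  exists f : X -> Cplx R, [/\ continuous f, f x = 1 & f y = 0].
Proof.
move=> yx.
have [|u [cu _ ux uy]] := @urysohn_point x (~` [set y]).
  apply: open_nbhs_nbhs; split; last by move=> /= xy; exact: yx.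
  exact/closed_openC/accessible_closed_set1/hausdorff_accessible.
exists (fun t => ((u t)%:C)%C); split.
- by move=> t; apply: (@continuous_RtoC R X u); exact: cu.
- by rewrite ux.
- suff -> : u y = 0 by [].
  by apply/eqP; apply: contra_notT yx => /uy /=.
Qed.

Lemma cabs_le_supn (f : X -> Cplx R) x : continuous f -> cabs (f x) <= supn f.
Proof.
move=> cf; apply: ub_le_sup; last by exists x.
have cg : continuous (fun y => cabs (f y)) by move=> y; apply: continuous_cabs; exact: cf.
have [|c _ hc] := @compact_EVT_max X R _ [set: X] _ cX (continuous_subspaceT cg).
  by exists x0.
by exists (cabs (f c)) => _ [y _ <-]; apply: hc; rewrite inE.
Qed.

Lemma supn_le (f : X -> Cplx R) M : (forall x, cabs (f x) <= M) -> supn f <= M.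
Proof.
move=> fM; apply: ge_sup; first by exists (cabs (f x0)), x0.
by move=> _ [y _ <-].
Qed.

Lemma supn_ge0 (f : X -> Cplx R) : continuous f -> 0 <= supn f.
Proof. by move=> cf; apply: le_trans (cabs_le_supn x0 cf); exact: cabs_ge0. Qed.

Definition fnorm a : \bar R := wsum (fun k => supn (a k)).

Lemma in_comm_cont a : in_comm a -> forall k, continuous (a k).
Proof. by case=> -[]. Qed.

Lemma in_comm_fin a : in_comm a -> (fnorm a < +oo)%E.
Proof. by case=> -[]. Qed.

Lemma in_comm_supp a : in_comm a -> forall k x, a k x != 0 -> Fix k x.
Proof. by case=> _ h k x ax; apply: (h k); exact: subset_closure. Qed.

(** Since [Fix k] is closed, the closure in the support condition comes for free. *)
Lemma in_commI a : (forall k, continuous (a k)) -> (fnorm a < +oo)%E ->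
  (forall k x, a k x != 0 -> Fix k x) -> in_comm a.
Proof.
move=> ca fa sa; split=> // k x hx.
apply: (Fix_closed cs csi hX); apply: closure_subset hx => y /=.
exact: sa.
Qed.

(** The set where a continuous function is nonzero is open; this is how the interiors of the sets
    Fix_k enter. *)
Lemma in_comm_interior a k x : in_comm a -> a k x != 0 -> interior (Fix k) x.
Proof.
move=> ha ax; have cax : 0 < cabs (a k x).
  rewrite lt_neqAle cabs_ge0 andbT eq_sym; apply: contraNN ax => /eqP.
  by move=> /cabs_eq0 ->.
have := @in_comm_cont a ha k x => /cvg_cplxP /(_ _ cax).
apply: filterS => y hy; apply: (in_comm_supp ha).
by apply: contraTneq hy => ->; rewrite sub0r cabsN ltxx.
Qed.

Lemma fnorm_fin a : in_comm a -> fnorm a = (fine (fnorm a))%:E.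
Proof.
move=> ha; apply: wsum_fin; last exact: in_comm_fin.
by move=> k; apply/supn_ge0/in_comm_cont.
Qed.

Lemma fnorm_ge0 a : in_comm a -> 0 <= fine (fnorm a).
Proof.
by move=> ha; apply/fine_ge0/wsum_ge0 => k; apply/supn_ge0/in_comm_cont.
Qed.

Lemma l1norm_le_fnorm a x : in_comm a -> (l1norm (fun k => a k x) <= fnorm a)%E.
Proof. by move=> ha; apply: le_wsum => k; apply/cabs_le_supn/in_comm_cont. Qed.

Lemma l1norm_at_fin a x : in_comm a -> (l1norm (fun k => a k x) < +oo)%E.
Proof. by move=> ha; apply: le_lt_trans (l1norm_le_fnorm x ha) (in_comm_fin ha). Qed.

Lemma cabs_le_fnorm a k x : in_comm a -> cabs (a k x) <= fine (fnorm a).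
Proof.
move=> ha; apply: (@le_trans _ _ (supn (a k))); first exact/cabs_le_supn/in_comm_cont.
rewrite -lee_fin -fnorm_fin//.
by apply: (@le_term_wsum _ (fun k => supn (a k))) => j; apply/supn_ge0/in_comm_cont.
Qed.

Lemma fnormD a b : in_comm a -> in_comm b ->
  (fnorm (fun k x => (a k x + b k x)%R) <= fnorm a + fnorm b)%E.
Proof.
move=> ha hb; rewrite -wsumD; try by move=> k; apply/supn_ge0/in_comm_cont.
apply: le_wsum => k; apply: supn_le => x; apply: le_trans (cabsD _ _) _.
by apply: lerD; apply/cabs_le_supn/in_comm_cont.
Qed.

Lemma in_commD a b : in_comm a -> in_comm b -> in_comm (fun k x => a k x + b k x).
Proof.
move=> ha hb; apply: in_commI.
- move=> k x; apply: (@continuousD _ _ _ (a k) (b k)); exact: in_comm_cont.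
- apply: le_lt_trans (fnormD ha hb) _.
  by apply: lte_add_pinfty; exact: in_comm_fin.
- move=> k x; have [ax|/(in_comm_supp ha)//] := eqVneq (a k x) 0.
  by rewrite ax add0r => /(in_comm_supp hb).
Qed.

Lemma fnormZ (c : Cplx R) a : in_comm a ->
  (fnorm (fun k x => (c * a k x)%R) <= (cabs c)%:E * fnorm a)%E.
Proof.
move=> ha; apply: le_trans (wsum_scale_le (cabs_ge0 c) _); last first.
  by move=> k; apply/supn_ge0/in_comm_cont.
apply: le_wsum => k; apply: supn_le => x; rewrite cabsM.
by rewrite ler_wpM2l ?cabs_ge0//; apply/cabs_le_supn/in_comm_cont.
Qed.

Lemma in_commZ (c : Cplx R) a : in_comm a -> in_comm (fun k x => c * a k x).
Proof.
move=> ha; apply: in_commI.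
- move=> k x; apply: (@continuousM _ _ (fun=> c) (a k)); first exact: cst_continuous.
  exact: in_comm_cont.
- apply: le_lt_trans (fnormZ c ha) _.
  by rewrite (fnorm_fin ha) -EFinM ltry.
- move=> k x cax; apply: (in_comm_supp ha).
  by apply: contraNneq cax => ->; rewrite mulr0.
Qed.

(** Where a_k(x) is nonzero, sigma^(-k) fixes x, so the twist in the product disappears. *)
Lemma l1mulE a b n x : in_comm a ->
  l1mul a b n x = convZ (fun k => a k x) (fun k => b k x) n.
Proof.
move=> ha; congr sumZ; apply/funext => k.
have [->|/(in_comm_supp ha)/(FixN sK siK)] := eqVneq (a k x) 0; first by rewrite !mul0r.
by rewrite /Defs.Fix /= => ->.
Qed.

(** Left multiplication by [a] is also bounded by [fnorm a] for the weaker supremum norm over all k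
    and x, in which the iteration of [neumann] is controlled. *)
Lemma l1mul_le a b n x M : in_comm a -> (forall k, cabs (b k x) <= M) ->
  cabs (l1mul a b n x) <= fine (fnorm a) * M.
Proof.
move=> ha bM; rewrite l1mulE// /convZ.
have M0 : 0 <= M by apply: le_trans (bM 0); exact: cabs_ge0.
have tM : (l1norm (fun k => (a k x * b (n - k) x)%R) <= (M * fine (fnorm a))%:E)%E.
  rewrite EFinM -fnorm_fin//.
  have ME : (0 <= M%:E)%E by rewrite lee_fin.
  apply: le_trans (lee_wpmul2l ME (l1norm_le_fnorm x ha)).
  apply: le_trans (wsum_scale_le M0 (fun k => cabs_ge0 (a k x))).
  by apply: le_wsum => k; rewrite cabsM mulrC ler_wpM2r// cabs_ge0.
rewrite mulrC -lee_fin; apply: (le_trans _ tM); apply: sumZ_le.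
by apply: le_lt_trans tM _; rewrite ltry.
Qed.

Lemma l1mulB a b b' n x : in_comm a -> in_comm b -> in_comm b' ->
  l1mul a b n x - l1mul a b' n x = l1mul a (fun k y => b k y - b' k y) n x.
Proof.
move=> ha hb hb'; rewrite !l1mulE// /convZ -sumZN; last first.
  exact: l1norm_conv_term_fin (l1norm_at_fin x ha) (l1norm_at_fin x hb').
rewrite -sumZD.
- by congr sumZ; apply/funext => k; rewrite mulrBr.
- exact: l1norm_conv_term_fin (l1norm_at_fin x ha) (l1norm_at_fin x hb).
- apply: le_lt_trans (l1norm_conv_term_fin n (l1norm_at_fin x ha) (l1norm_at_fin x hb')).
  by apply: l1norm_le => k; rewrite cabsN.
Qed.

Lemma fnorm_mul a b : in_comm a -> in_comm b ->
  (fnorm (l1mul a b) <= fnorm b * fnorm a)%E.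
Proof.
move=> ha hb.
have sa k : 0 <= supn (a k) by apply/supn_ge0/in_comm_cont.
have sb k : 0 <= supn (b k) by apply/supn_ge0/in_comm_cont.
apply: le_trans (wsum_conv_le sa sb (in_comm_fin hb)).
apply: le_esum => n _.
have W0 : (0 <= wsum (fun k => (supn (a k) * supn (b (n - k)))%R))%E.
  by apply: wsum_ge0 => k; rewrite mulr_ge0.
(* If this weight is infinite there is nothing to prove; otherwise it is a real bound, uniform in
   x. *)
case Wn : (wsum (fun k => (supn (a k) * supn (b (n - k)))%R)) W0 => [M| |]// _; last first.
  exact: leey.
rewrite lee_fin; apply: supn_le => x; rewrite l1mulE// -lee_fin -Wn.
have fin := l1norm_conv_term_fin n (l1norm_at_fin x ha) (l1norm_at_fin x hb).
apply: le_trans (sumZ_le fin) _; apply: le_wsum => k; rewrite cabsM.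
by apply: ler_pM; rewrite ?cabs_ge0//; apply/cabs_le_supn/in_comm_cont.
Qed.

Lemma in_commM a b : in_comm a -> in_comm b -> in_comm (l1mul a b).
Proof.
move=> ha hb.
have sa k : 0 <= supn (a k) by apply/supn_ge0/in_comm_cont.
have B0 := fnorm_ge0 hb.
apply: in_commI.
- move=> n x.
  rewrite (_ : l1mul a b n = (fun y => sumZ (fun k => a k y * b (n - k) y))); last first.
    by apply/funext => y; rewrite l1mulE.
  have bd k y : cabs (a k y * b (n - k) y) <= fine (fnorm b) * supn (a k).
    rewrite cabsM mulrC; apply: ler_pM; rewrite ?cabs_ge0//.
      exact: cabs_le_fnorm.
    exact/cabs_le_supn/in_comm_cont.
  apply: (@sumZ_dominated_cvg R X (nbhs x) _ (fun k y => a k y * b (n - k) y)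
    (fun k => a k x * b (n - k) x) (fun k => fine (fnorm b) * supn (a k))) => //.
  + apply: le_lt_trans (wsum_scale_le B0 sa) _.
    by rewrite -/(fnorm a) (fnorm_fin ha) -EFinM ltry.
  + move=> k; apply: (@continuousM _ _ (a k) (b (n - k))); exact: in_comm_cont.
  + by apply: nearW => y k; exact: bd.
- apply: le_lt_trans (fnorm_mul ha hb) _.
  by rewrite (fnorm_fin ha) (fnorm_fin hb) -EFinM ltry.
(* A nonzero term at k would put x in both Fix_k and Fix_(n-k), hence in Fix_n; off Fix_n the sum
   vanishes term by term. *)
- move=> n x; apply: contra_neqP => nfix; rewrite l1mulE// /convZ.
  rewrite -[RHS](@sumZ_delta R 0 0); congr sumZ; apply/funext => k.
  rewrite /deltaZ if_same.
  have [->|ak] := eqVneq (a k x) 0; first by rewrite mul0r.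
  have [->|bk] := eqVneq (b (n - k) x) 0; first by rewrite mulr0.
  exfalso; apply: nfix.
  rewrite -(subrK k n); apply: FixD => //; first exact: (in_comm_supp hb).
  exact: (in_comm_supp ha).
Qed.

(* The element [f delta^k]. *)
Definition monoZ (k : int) (f : X -> Cplx R) : int -> X -> Cplx R :=
  fun j x => deltaZ k (f x) j.

Lemma fnorm_mono k f M : (forall x, cabs (f x) <= M) -> (fnorm (monoZ k f) <= M%:E)%E.
Proof.
move=> fM; have M0 : 0 <= M by apply: le_trans (fM x0); exact: cabs_ge0.
apply: (@le_trans _ _ (l1norm (deltaZ k (M%:C)%C))); last first.
  by apply: le_trans (l1norm_delta _ _) _; rewrite cabs_real ger0_norm.
apply: le_wsum => j; apply: supn_le => x; rewrite /monoZ /deltaZ.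
by case: eqP; rewrite ?cabs0// cabs_real ger0_norm.
Qed.

Lemma in_comm_mono k f : continuous f -> (forall x, f x != 0 -> Fix k x) ->
  in_comm (monoZ k f).
Proof.
move=> cf sf; apply: in_commI.
- move=> j x; rewrite /monoZ /deltaZ; case: eqP => _; last exact: cst_continuous.
  exact: cf.
- apply: le_lt_trans (fnorm_mono k (fun x => cabs_le_supn x cf)) _.
  by rewrite ltry.
- move=> j x; rewrite /monoZ /deltaZ; case: (eqVneq j k) => [->|]; first exact: sf.
  by rewrite eqxx.
Qed.

Lemma mono_mul j k f g : continuous f -> (forall x, f x != 0 -> Fix j x) ->
  l1mul (monoZ j f) (monoZ k g) = monoZ (j + k) (fun x => f x * g x).
Proof.
move=> cf sf; apply/funext => n; apply/funext => x.
rewrite l1mulE; last exact: in_comm_mono.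
rewrite /convZ -[RHS](sumZ_delta j); congr sumZ; apply/funext => i.
rewrite /monoZ /deltaZ; case: (eqVneq i j) => [->|_]; last by rewrite mul0r.
by rewrite subr_eq [k + j]addrC; case: eqP => // _; rewrite mulr0.
Qed.

Lemma in_comm0 : in_comm (fun _ _ => 0).
Proof.
apply: in_commI.
- by move=> k x; exact: cst_continuous.
- apply: (@le_lt_trans _ _ 0%E) => //.
  rewrite /fnorm /wsum esum1// => k _; congr EFin; apply/le_anti.
  rewrite supn_le /=; last by move=> x; rewrite le_eqVlt (introT eqP (cabs0 R)).
  by apply: supn_ge0 => x; exact: cst_continuous.
- by move=> k x; rewrite eqxx.
Qed.

Lemma in_commN a : in_comm a -> in_comm (fun k x => - a k x).
Proof.
move=> ha; rewrite (_ : (fun k x => - a k x) = (fun k x => -1 * a k x)).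
  exact: in_commZ.
by apply/funext => k; apply/funext => x; rewrite mulN1r.
Qed.

(* Completeness of the algebra, in the form of the fixed point of [b |-> a + a b]. *)
Lemma neumann a : in_comm a -> fine (fnorm a) < 1 ->
  exists2 b, in_comm b & b = (fun k x => a k x + l1mul a b k x).
Proof.
move=> ha; set r := fine (fnorm a) => r1.
have r0 : 0 <= r by exact: fnorm_ge0.
have r01 : 0 <= r < 1 by rewrite r0.
have d0 : 0 < 1 - r by rewrite subr_gt0.
(* [C] solves r + rC = C, so the norm bound [C] is preserved by b -> a + ab; it is the sum of the
   geometric series r + r^2 + ... *)
pose C := r / (1 - r).
have C0 : 0 <= C by rewrite divr_ge0// ltW.
pose fix B n : int -> X -> Cplx R :=
  if n is m.+1 then (fun k x => a k x + l1mul a (B m) k x) else (fun _ _ => 0).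
have hB n : in_comm (B n).
  elim: n => [|n IH] /=; first exact: in_comm0.
  by apply: in_commD => //; exact: in_commM.
have nB n : (fnorm (B n) <= C%:E)%E.
  elim: n => [|n IH].
    rewrite /fnorm /wsum esum1 ?lee_fin// => k _; congr EFin; apply/le_anti.
    rewrite supn_le /=; last by move=> x; rewrite le_eqVlt (introT eqP (cabs0 R)).
    by apply: supn_ge0 => x; exact: cst_continuous.
  apply: le_trans (fnormD ha (in_commM ha (hB n))) _.
  have ra : (0 <= fnorm a)%E by rewrite fnorm_fin// lee_fin.
  apply: le_trans (leeD2l _ (fnorm_mul ha (hB n))) _.
  apply: le_trans (leeD2l _ (lee_wpmul2r ra IH)) _.
  rewrite (fnorm_fin ha) -/r -EFinM -EFinD lee_fin /C.
  by rewrite le_eqVlt; apply/orP; left; apply/eqP; field; rewrite gt_eqF.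
(* Since B 0 = 0, the distance to it is at most [C], and each step contracts by the factor r. *)
have cB n m k x : (n <= m)%N -> cabs (B m k x - B n k x) <= r ^+ n * C.
  elim: n m k x => [|n IH] m k x.
    move=> _; rewrite expr0 mul1r subr0; apply: le_trans (cabs_le_fnorm k x (hB m)) _.
    by rewrite -lee_fin -fnorm_fin.
  case: m => // m nm /=; rewrite opprD addrACA subrr add0r l1mulB//.
  by rewrite exprS -mulrA; apply: l1mul_le => // j; exact: IH.
have /choice [b hb] : forall p : int * X, exists l,
    forall n, cabs (l - B n p.1 p.2) <= 2 * (r ^+ n * C).
  by move=> [k x]; apply: cplx_tail_limit => n m; exact: cB.
pose b' k x := b (k, x).
have {}hb k x n : cabs (b' k x - B n k x) <= 2 * (r ^+ n * C) by exact: (hb (k, x)).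
have small e : 0 < e -> exists n, 2 * (r ^+ n * C) < e.
  move=> e0; have e2 : 0 < e / 2 by rewrite divr_gt0.
  have [n hn] := geom_lt C r01 e2.
  by exists n; rewrite mulrC -ltr_pdivlMr.
have b'c : in_comm b'.
  apply: in_commI.
  - move=> k x; apply/cvg_cplxP => e e0.
    have e3 : 0 < e / 3 by rewrite divr_gt0.
    have [n hn] := small _ e3.
    have /cvg_cplxP /(_ _ e3) := in_comm_cont (hB n) (x := x) (k := k).
    apply: filterS => y hy.
    apply: le_lt_trans (cabs_dist _ (B n k y) _) _.
    apply: le_lt_trans (lerD (lexx _) (cabs_dist _ (B n k x) _)) _.
    have h1 := hb k y n; have h2 := hb k x n; rewrite cabsB in h2; lra.
  (* Uniform convergence alone does not give summability of the limit; the common norm bound [C] of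
     the iterates does. *)
  - apply: (@wsum_le_limit R _ (fun n k => supn (B n k)) (fun n => 2 * (r ^+ n * C)) C).
    + by move=> n k; apply/supn_ge0/in_comm_cont.
    + exact: nB.
    + move=> n k; apply: supn_le => x; rewrite -[b' k x](subrK (B n k x)) addrC.
      apply: le_trans (cabsD _ _) _; apply: lerD; last exact: hb.
      exact/cabs_le_supn/in_comm_cont.
    + have rn : `|r| < 1 by rewrite ger0_norm.
      rewrite -[0](mulr0 (2 : R)) -[X in _ * X](mul0r C).
      apply: cvgM; first exact: cvg_cst.
      by apply: cvgM; [exact: cvg_expr|exact: cvg_cst].
  - move=> k x; apply: contra_neqP => nf; apply: cabs_eq0; apply/le_anti.
    rewrite cabs_ge0 andbT; apply/ler_addgt0Pr => e /small [n hn].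
    have := hb k x n.
    have -> : B n k x = 0.
      by apply/eqP; apply: contra_notT nf; exact: in_comm_supp.
    by rewrite subr0 add0r => h; apply: le_trans h (ltW hn).
exists b' => //; apply/funext => k; apply/funext => x.
apply/eqP; rewrite -subr_eq0; apply/eqP.
apply: cabs_eq0; apply/le_anti; rewrite cabs_ge0 andbT.
apply/ler_addgt0Pr => e e0.
have e2 : 0 < e / 2 by rewrite divr_gt0.
have [n hn] := small _ e2; rewrite add0r.
(* Both sides are compared with the next iterate, whose difference from a + ab' is a(B n - b'). *)
apply: le_trans (cabs_dist _ (B n.+1 k x) _) _.
rewrite /= [X in _ + cabs X](_ : _ = l1mul a (B n) k x - l1mul a b' k x); last first.
  by rewrite opprD addrACA subrr add0r.
rewrite l1mulB//.
have h1 : cabs (l1mul a (fun j y => B n j y - b' j y) k x) <= r * (2 * (r ^+ n * C)).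
  by apply: l1mul_le => // j; rewrite cabsB; exact: hb.
have h2 := hb k x n.+1.
rewrite exprS in h2.
have q0 : 0 <= r ^+ n * C by rewrite mulr_ge0// exprn_ge0.
have h3 : r * (2 * (r ^+ n * C)) <= 2 * (r ^+ n * C).
  by rewrite ler_piMl// ?(ltW r1)// mulr_ge0.
apply: le_trans (lerD h2 h1) _.
have -> : 2 * (r * r ^+ n * C) = r * (2 * (r ^+ n * C)) by ring.
lra.
Qed.

(** * Characters *)

Local Notation Comm := (Comm R sigma sigmai).

Lemma comm_eq (c c' : Comm) : cval c = cval c' -> c = c'.
Proof. by case: c c' => c hc [c' hc'] /= e; case: _ / e hc' => hc'; congr MkComm. Qed.

(* A functional on the algebra, as a function of families (0 off the algebra). *)
Definition onfam (phi : Comm -> Cplx R) a : Cplx R :=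
  match pselect (in_comm a) with left h => phi (MkComm h) | right _ => 0 end.

Lemma onfamE phi (c : Comm) : onfam phi c = phi c.
Proof.
rewrite /onfam; case: pselect => [h|/(_ (cvalP c))//]; congr phi.
exact: comm_eq.
Qed.

Section Character.
Variable phi : Comm -> Cplx R.
Hypothesis hphi : is_character phi.
Local Notation ph := (onfam phi).

Lemma charD a b : in_comm a -> in_comm b -> ph (fun k x => a k x + b k x) = ph a + ph b.
Proof.
move=> ha hb; have hc := in_commD ha hb.
rewrite -[a]/(cval (MkComm ha)) -[b]/(cval (MkComm hb)).
rewrite -[LHS]/(ph (cval (MkComm hc))) !onfamE.
by case: hphi => h _ _ _; exact: h.
Qed.

Lemma charZ (l : Cplx R) a : in_comm a -> ph (fun k x => l * a k x) = l * ph a.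
Proof.
move=> ha; have hc := in_commZ l ha.
rewrite -[a]/(cval (MkComm ha)) -[LHS]/(ph (cval (MkComm hc))) !onfamE.
by case: hphi => _ h _ _; exact: h.
Qed.

Lemma charM a b : in_comm a -> in_comm b -> ph (l1mul a b) = ph a * ph b.
Proof.
move=> ha hb; have hc := in_commM ha hb.
rewrite -[a]/(cval (MkComm ha)) -[b]/(cval (MkComm hb)).
rewrite -[LHS]/(ph (cval (MkComm hc))) !onfamE.
by case: hphi => _ _ h _; exact: h.
Qed.

Lemma char_bound a : in_comm a -> cabs (ph a) <= fine (fnorm a).
Proof.
move=> ha; rewrite leNgt; apply/negP => lt.
have l0 : 0 < cabs (ph a) by apply: le_lt_trans lt; exact: fnorm_ge0.
have pn0 : ph a != 0 by apply: contraTneq l0 => ->; rewrite cabs0 ltxx.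
pose a' := fun k x => (ph a)^-1 * a k x.
have ha' : in_comm a' by exact: in_commZ.
have [|b hb be] := neumann ha'.
  apply: (@le_lt_trans _ _ ((cabs (ph a))^-1 * fine (fnorm a))).
    rewrite -lee_fin -(fnorm_fin ha') EFinM -(fnorm_fin ha) -cabsV.
    exact: fnormZ.
  by rewrite ltr_pdivrMl// mulr1.
have := congr1 ph be; rewrite charD//; last exact: in_commM.
rewrite charM// /a' charZ// mulVf// mul1r => /eqP.
by rewrite -subr_eq0 opprD addrCA subrr addr0 oppr_eq0 oner_eq0.
Qed.

Local Notation ev k f := (ph (monoZ k f)).
Implicit Types f g : X -> Cplx R.

Lemma Fix0 (f : X -> Cplx R) x : f x != 0 -> Fix 0 x.
Proof. by []. Qed.

Lemma char_monoM j k f g : continuous f -> continuous g ->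
  (forall x, f x != 0 -> Fix j x) -> (forall x, g x != 0 -> Fix k x) ->
  ev (j + k) (fun x => f x * g x) = ev j f * ev k g.
Proof.
move=> cf cg sf sg.
rewrite -(charM (in_comm_mono cf sf) (in_comm_mono cg sg)).
by rewrite (mono_mul k g cf sf).
Qed.

Lemma char_monoD k f g : continuous f -> continuous g ->
  (forall x, f x != 0 -> Fix k x) -> (forall x, g x != 0 -> Fix k x) ->
  ev k (fun x => f x + g x) = ev k f + ev k g.
Proof.
move=> cf cg sf sg; rewrite -(charD (in_comm_mono cf sf) (in_comm_mono cg sg)).
congr (onfam phi); apply/funext => j; apply/funext => x; rewrite /monoZ /deltaZ.
by case: eqP; rewrite ?addr0.
Qed.

Lemma char_monoZ k (l : Cplx R) f : continuous f ->
  (forall x, f x != 0 -> Fix k x) ->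
  ev k (fun x => l * f x) = l * ev k f.
Proof.
move=> cf sf; rewrite -(charZ l (in_comm_mono cf sf)).
congr (onfam phi); apply/funext => j; apply/funext => x; rewrite /monoZ /deltaZ.
by case: eqP; rewrite ?mulr0.
Qed.

(** A character is only assumed nonzero at some a; cancelling phi(a) in phi(1)phi(a) = phi(a) gives
    the value at the unit. *)
Lemma char_one : ev 0 (fun=> 1) = 1.
Proof.
have c1 : continuous (fun _ : X => 1 : Cplx R) by move=> x; exact: cst_continuous.
case: (hphi) => _ _ _ [a a0].
have h1 : in_comm (monoZ 0 (fun=> 1)) by apply: in_comm_mono => // x _.
have := charM h1 (cvalP a).
rewrite (_ : l1mul _ _ = a) ?onfamE; last first.
  apply/funext => n; apply/funext => x; rewrite l1mulE// /convZ.
  rewrite -[RHS](sumZ_delta 0); congr sumZ; apply/funext => k.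
  rewrite /monoZ /deltaZ; case: eqP => [->|_]; last by rewrite mul0r.
  by rewrite subr0 mul1r.
by move=> h; apply: (mulIf a0); rewrite -h mul1r.
Qed.

(* The sets [h < e], for [h] nonnegative with [phi h = 0], form a proper filter,
   as a positive function is invertible; [x] is a cluster point of it. *)
Lemma char_eval : exists x, forall f, continuous f -> ev 0 f = f x.
Proof.
pose RC (h : X -> R) := (fun y => ((h y)%:C)%C : Cplx R).
have cRC h : continuous h -> continuous (RC h).
  by move=> ch y; apply: continuous_RtoC; exact: ch.
pose F := [set A : set X | exists h : X -> R, [/\ continuous h, forall y, 0 <= h y,
  ev 0 (RC h) = 0 & exists2 e, 0 < e & forall y, h y < e -> A y]].
have FF : Filter F.
  split.
  - exists (fun=> 0); split=> //; first by move=> y; exact: cst_continuous.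
      transitivity (0 * ev 0 (fun=> 1)); last by rewrite mul0r.
      rewrite -char_monoZ//; last by move=> y; exact: cst_continuous.
      by congr (onfam phi); congr monoZ; apply/funext => y; rewrite mul0r.
    by exists 1.
  - move=> A B [h [ch h0 ph0 [e e0 hA]]] [g [cg g0 pg0 [d d0 gB]]].
    (* The sum of two nonnegative functions dominates each of them, and it stays in the kernel. *)
    exists (fun y => h y + g y); split.
    + by move=> y; apply: (@continuousD _ _ _ h g); [exact: ch|exact: cg].
    + by move=> y; rewrite addr_ge0.
    + transitivity (ev 0 (RC h) + ev 0 (RC g)); last by rewrite ph0 pg0 addr0.
      rewrite -char_monoD//; try exact: cRC.
      congr (onfam phi); congr monoZ; apply/funext => y; exact: rmorphD.
    + exists (Num.min e d); first by rewrite lt_min e0.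
      move=> y; rewrite lt_min => /andP[h1 h2]; split.
        by apply: hA; apply: le_lt_trans h1; rewrite lerDl.
      by apply: gB; apply: le_lt_trans h2; rewrite lerDr.
  - move=> A B AB [h [ch h0 ph0 [e e0 hA]]]; exists h; split=> //.
    by exists e => // y /hA /AB.
have FP : ProperFilter F.
  split=> // -[h [ch h0 ph0 [e e0 he]]].
  have hp y : 0 < h y by apply: lt_le_trans e0 _; rewrite leNgt; apply/negP => /he.
  have ci : continuous (fun y => (h y)^-1).
    by move=> y; apply: (@continuousV _ _ h); [rewrite gt_eqF|exact: ch].
  have := @char_monoM 0 0 (RC h) (RC (fun y => (h y)^-1)) (cRC _ ch) (cRC _ ci)
    (fun x _ => erefl) (fun x _ => erefl).
  rewrite ph0 mul0r addr0.
  rewrite (_ : (fun x => _) = (fun=> 1)) ?char_one.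
    by move=> /eqP; rewrite oner_eq0.
  by apply/funext => y; rewrite /RC -rmorphM /= mulfV ?gt_eqF.
have [x [_ xF]] := cX FP filterT.
exists x => f cf; pose c := ev 0 f.
(* g = f - phi(f) lies in the kernel of phi; the constant is written as a multiple of 1 so that
   homogeneity applies. *)
pose g := fun y => f y + - c * 1.
have c1 : continuous (fun _ : X => 1 : Cplx R) by move=> y; exact: cst_continuous.
have cc : continuous (fun _ : X => - c * 1 : Cplx R) by move=> y; exact: cst_continuous.
have cg : continuous g.
  by move=> y; apply: (@continuousD _ _ _ f (fun=> - c * 1)); [exact: cf|exact: cc].
have g0 : ev 0 g = 0.
  rewrite (char_monoD cf cc (@Fix0 f) (@Fix0 _)) (char_monoZ (- c) c1 (@Fix0 _)).
  by rewrite char_one mulr1 subrr.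
(* |g|^2 = conj(g) g is a nonnegative real function in the kernel, so its sublevel sets belong to
   [F]; at the cluster point x it must vanish, which says f(x) = phi(f). *)
pose h y := cabs (g y) ^+ 2.
have ch : continuous h.
  move=> y; rewrite /h; under [fun _ => _]funext do rewrite expr2.
  apply: (@continuousM _ _ (fun y => cabs (g y)) (fun y => cabs (g y)));
    apply: continuous_cabs; exact: cg.
have h0 y : 0 <= h y by rewrite exprn_ge0// cabs_ge0.
have ph0 : ev 0 (RC h) = 0.
  transitivity (ev 0 (fun y => ((g y : R[i])^*)%C : Cplx R) * ev 0 g); last by rewrite g0 mulr0.
  rewrite -(char_monoM (conj_continuous cg) cg (@Fix0 _) (@Fix0 g)).
  by congr (onfam phi); rewrite addr0; congr monoZ; apply/funext => y; rewrite conj_mul.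
suff hx : h x = 0.
  move/eqP: hx; rewrite sqrf_eq0 => /eqP /cabs_eq0.
  by rewrite /g mulr1 => /eqP; rewrite subr_eq0 => /eqP ->.
apply/le_anti; rewrite h0 andbT; apply/ler_addgt0Pr => e e0; rewrite add0r.
have e2 : 0 < e / 2 by rewrite divr_gt0.
have FA : F [set y | h y < e / 2] by exists h; split=> //; exists (e / 2).
have := ch x => /cvgrPdist_lt /(_ _ e2) nx.
have [y [/= hy]] := xF _ _ FA nx.
rewrite ltr_norml => /andP[_]; lra.
Qed.

Lemma char_mono_zero x : (forall f, continuous f -> ev 0 f = f x) ->
  forall k f, continuous f -> (forall y, f y != 0 -> Fix k y) -> f x = 0 ->
  ev k f = 0.
Proof.
move=> evx k f cf sf fx; apply: cabs_eq0; apply/le_anti.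
rewrite cabs_ge0 andbT; apply/ler_addgt0Pr => e e0; rewrite add0r.
have p1 y : 0 < 1 + cabs (f y) / e.
  by rewrite ltr_pwDl// divr_ge0 ?cabs_ge0// ltW.
pose h y : Cplx R := ((1 + cabs (f y) / e)^-1)%:C%C.
have ch : continuous h.
  move=> y; apply: (@continuous_RtoC R X (fun y => (1 + cabs (f y) / e)^-1)).
  apply: (@continuousV _ _ (fun y => 1 + cabs (f y) / e)); first by rewrite gt_eqF.
  apply: (@continuousD _ _ _ (fun _ : X => 1 : R) (fun y => cabs (f y) / e : R));
    first exact: cst_continuous.
  apply: (@continuousM _ _ (fun y => cabs (f y) : R) (fun _ : X => e^-1 : R));
    last exact: cst_continuous.
  by apply: continuous_cabs; exact: cf.
have hx : h x = 1 by rewrite /h fx cabs0 mul0r addr0 invr1.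
have -> : ev k f = ev k (fun y => f y * h y).
  by rewrite -{2}(addr0 k) (char_monoM cf ch sf (@Fix0 h)) (evx _ ch) hx mulr1.
have cfh : continuous (fun y => f y * h y).
  by move=> y; apply: (@continuousM _ _ f h); [exact: cf|exact: ch].
have sfh y : f y * h y != 0 -> Fix k y.
  by move=> fh; apply: sf; apply: contraNneq fh => ->; rewrite mul0r.
have hm := in_comm_mono cfh sfh.
apply: le_trans (char_bound hm) _.
rewrite -lee_fin -fnorm_fin//; apply: fnorm_mono => y.
have iv : 0 <= (1 + cabs (f y) / e)^-1 by rewrite invr_ge0 ltW.
rewrite cabsM /h cabs_real (ger0_norm iv).
by rewrite ler_pdivrMr// mulrDr mulr1 mulrCA divff ?gt_eqF// mulr1 lerDr ltW.
Qed.

Lemma char_mono : exists x (z : Cplx R), circle z /\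
  forall k f, continuous f -> (forall y, f y != 0 -> Fix k y) -> ev k f = f x * z ^ k.
Proof.
have [x evx] := char_eval; exists x.
have f0 k (f : X -> Cplx R) : continuous f -> (forall y, f y != 0 -> Fix k y) ->
    f x != 0 -> interior (Fix k) x.
  move=> cf sf fx; apply: (@in_comm_interior (monoZ k f)); first exact: in_comm_mono.
  by rewrite /monoZ /deltaZ eqxx.
have [[q0 hq0]|noq] := pselect (exists q : nat, (0 < q)%N /\ interior (Fix q%:Z) x); last first.
  (* No coefficient with k nonzero survives at x, so every z gives the same character. *)
  exists 1; split; first exact: cabs1.
  move=> k f cf sf; rewrite exp1rz mulr1.
  have [->|k0] := eqVneq k 0; first exact: evx.
  have [fx|/(f0 k f cf sf) kx] := eqVneq (f x) 0.
    by rewrite fx; exact: (char_mono_zero evx).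
  exfalso; apply: noq; exists `|k|%N; split; first by rewrite absz_gt0.
  by case: (k) kx => // n; rewrite NegzE => /(Fix_interiorN sK siK); rewrite opprK abszN.
pose P q := (0 < q)%N && `[< interior (Fix q%:Z) x >].
have exP : exists q, P q by exists q0; case: hq0 => q1 q2; rewrite /P q1; apply/asboolP.
case: (ex_minnP exP) => n /andP[n0 /asboolP hn] nmin.
have {}nmin m : (0 < m < n)%N -> ~ interior (Fix m%:Z) x.
  move=> /andP[m0 mn] hm; have := nmin m; rewrite /P m0 /= leqNgt mn => h.
  by apply: notF; apply: h; apply/asboolP.
have [u [cu u01 ux un]] := urysohn_point hn.
pose U y : Cplx R := (u y)%:C%C.
have cU : continuous U by move=> y; apply: (@continuous_RtoC R X u); exact: cu.
have Ux : U x = 1 by rewrite /U ux.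
have Un y : U y != 0 -> Fix n%:Z y.
  by move=> Uy; apply: un; apply: contraNneq Uy; rewrite /U => ->.
have UNn y : U y != 0 -> Fix (- n%:Z) y by move=> /Un /(FixN sK siK).
have U1 y : cabs (U y) <= 1.
  by rewrite cabs_real; have /andP[a b] := u01 y; rewrite ger0_norm.
pose w := ev n%:Z U; pose w' := ev (- n%:Z) U.
have ww' : w * w' = 1.
  rewrite -(char_monoM cU cU Un UNn) subrr evx; first by rewrite Ux mulr1.
  by move=> y; apply: (@continuousM _ _ U U); exact: cU.
have bd k : (forall y, U y != 0 -> Fix k y) -> cabs (ev k U) <= 1.
  move=> sU; have hm := in_comm_mono cU sU.
  apply: le_trans (char_bound hm) _.
  by rewrite -lee_fin -fnorm_fin//; exact: fnorm_mono.
have w1 : cabs w = 1.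
  (* Two numbers in the closed unit disc with product 1 have modulus 1. *)
  have h1 : cabs w <= 1 := bd _ Un; have h2 : cabs w' <= 1 := bd _ UNn.
  have := congr1 (@cabs R) ww'; rewrite cabsM cabs1 => h3.
  by apply/le_anti; rewrite h1 -h3 /= ler_piMr// cabs_ge0.
have wn0 : w != 0.
  by apply/eqP => w0; move/eqP: ww'; rewrite w0 mul0r eq_sym oner_eq0.
have wE : w' = w^-1 by rewrite -[LHS](mulKf wn0) ww' mulr1.
have key j : forall f, continuous f -> (forall y, f y != 0 -> Fix (j * n%:Z) y) ->
    ev (j * n%:Z) f = f x * w ^ j.
  have cfU f : continuous f -> continuous (fun y => f y * U y).
    by move=> cf y; apply: (@continuousM _ _ f U); [exact: cf|exact: cU].
  have nz (f : X -> Cplx R) y : f y * U y != 0 -> f y != 0 /\ U y != 0.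
    by rewrite mulf_eq0 negb_or => /andP[].
  elim/int_rect: j => [|j IH|j IH] f cf sf.
  - by rewrite mul0r expr0z mulr1 evx.
  (* [f] is supported in Fix_((j+1)n) and [U] in Fix_(-n), so fU is admissible in degree jn and has
     the same value as [f] at x. The induction hypothesis for fU, divided by w' = 1/w, gives the
     claim for [f]; the negative direction uses w instead. *)
  - have e1 : j%:Z * n%:Z = j.+1%:Z * n%:Z + - n%:Z by rewrite -addn1 PoszD mulrDl mul1r addrK.
    have := IH _ (cfU f cf); rewrite e1 (char_monoM cf cU sf UNn) -/w' wE Ux mulr1 => h.
    apply: (mulIf (invr_neq0 wn0)); rewrite h.
      by rewrite exprSzr mulrA mulfK.
    move=> y /nz [fy Uy]; apply: (FixD sK siK); [exact: sf|exact: UNn].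
  - have e1 : - j%:Z * n%:Z = - j.+1%:Z * n%:Z + n%:Z.
      by rewrite -addn1 PoszD opprD mulrDl mulN1r subrK.
    have := IH _ (cfU f cf); rewrite e1 (char_monoM cf cU sf Un) -/w Ux mulr1 => h.
    apply: (mulIf wn0); rewrite h.
      rewrite -mulrA; congr (_ * _).
      rewrite -[X in _ = _ * X](expr1z w) -(expfzDr _ _ wn0); congr (_ ^ _); lia.
    move=> y /nz [fy Uy]; apply: (FixD sK siK); [exact: sf|exact: Un].
pose z : Cplx R := n.-root (w : R[i]).
have zn : z ^+ n = w by exact: rootCK.
have z1 : cabs z = 1.
  by apply/eqP; rewrite -(@pexpr_eq1 _ _ n) ?cabs_ge0// -cabsX zn w1.
exists z; split=> // k f cf sf.
have [fx|fx] := eqVneq (f x) 0; first by rewrite fx mul0r; exact: (char_mono_zero evx).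
have [j jE] := Fix_interior_dvd sK siK n0 hn nmin (f0 k f cf sf fx).
rewrite jE in sf *; rewrite key// -zn; congr (_ * _).
by rewrite mulrC -exprz_exp.
Qed.

Lemma char_psi : exists x (z : Cplx R), circle z /\ psi sigma sigmai x z = phi.
Proof.
have [x [z [z1 evz]]] := char_mono; exists x, z; split=> //.
apply/funext => c; rewrite -[RHS]onfamE; set a := cval c; have ha : in_comm a := cvalP c.
pose u k := a k x * z ^ k; change (sumZ u = ph a).
have ua k : cabs (u k) <= supn (a k).
  by rewrite cabsM circle_expz// mulr1; apply/cabs_le_supn/in_comm_cont.
have fu : (l1norm u < +oo)%E by apply: le_lt_trans (in_comm_fin ha); exact: le_wsum.
pose tr N k y := truncZ N (fun j => a j y) k.
have htr N : in_comm (tr N).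
  apply: in_commI.
  - move=> k; rewrite (_ : tr N k = if (zrank k < N)%N then a k else (fun=> 0)).
      by case: ifP => _; [exact: in_comm_cont|move=> y; exact: cst_continuous].
    by apply/funext => y; rewrite /tr /truncZ; case: ifP.
  - apply: le_lt_trans (in_comm_fin ha); apply: le_wsum => k; apply: supn_le => y.
    rewrite /tr /truncZ; case: ifP => _; first exact/cabs_le_supn/in_comm_cont.
    by rewrite cabs0; apply/supn_ge0/in_comm_cont.
  - move=> k y; rewrite /tr /truncZ; case: ifP => _; first exact: in_comm_supp.
    by rewrite eqxx.
have hm k : in_comm (monoZ k (a k)).
  by apply: in_comm_mono; [exact: in_comm_cont|exact: in_comm_supp].
have ptr N : ph (tr N) = psumZ u N.
  elim: N => [|N IH].
    rewrite /psumZ !big_nil addr0 -(mul0r (ph a)) -charZ//.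
    by congr (onfam phi); apply/funext => k; apply/funext => y; rewrite mul0r.
  have -> : tr N.+1 = (fun k y => tr N k y + (monoZ (Posz N) (a (Posz N)) k y
      + monoZ (Negz N) (a (Negz N)) k y)).
    by apply/funext => k; apply/funext => y; rewrite /tr truncZS.
  rewrite charD//; last exact: in_commD.
  rewrite charD// IH /psumZ !big_nat_recr//= [RHS]addrACA.
  by rewrite !evz//; (try exact: in_comm_cont); exact: in_comm_supp.
apply/eqP; rewrite eq_sym -subr_eq0; apply/eqP; apply: cabs_eq0; apply/le_anti.
rewrite cabs_ge0 andbT; apply/ler_addgt0Pr => e e0; rewrite add0r.
have e2 : 0 < e / 2 by rewrite divr_gt0.
have sa k : 0 <= supn (a k) by apply/supn_ge0/in_comm_cont.
(* The same tail bounds two errors: that of the partial sum at x, and the norm of a minus its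
   truncation, which bounds the error under phi. *)
have [N /(_ _ (leqnn N)) hN] := wtail_small sa (in_comm_fin ha) e2.
apply: le_trans (cabs_dist _ (psumZ u N) _) _.
rewrite [e]splitr; apply: lerD; last first.
  rewrite cabsB -lee_fin; apply: le_trans (sumZ_psumZ_dist N fu) _.
  apply: le_trans (ltW hN); apply: le_esum => k _.
  by rewrite lee_fin.
have hd : in_comm (fun k y => a k y + - tr N k y) by apply: in_commD => //; exact: in_commN.
have -> : ph a - psumZ u N = ph (fun k y => a k y + - tr N k y).
  rewrite -ptr charD//; last exact: in_commN.
  congr (_ + _); rewrite -mulN1r -charZ//; congr (onfam phi).
  by apply/funext => k; apply/funext => y; rewrite mulN1r.
apply: le_trans (char_bound hd) _.
rewrite -lee_fin -fnorm_fin//; apply: le_trans (ltW hN).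
rewrite /wtail esum_mkcond; apply: le_esum => k _.
rewrite /tr /truncZ.
have -> : (k \in [set k | (N <= zrank k)%N]) = (N <= zrank k)%N.
  by apply/idP/idP; rewrite inE.
case: leqP => _; rewrite lee_fin; apply: supn_le => y; last by rewrite subrr cabs0.
by rewrite subr0; apply/cabs_le_supn/in_comm_cont.
Qed.

End Character.

(** * The map psi *)

Lemma psi_fin x z (a : Comm) : circle z -> (l1norm (fun k => (a k x * z ^ k)%R) < +oo)%E.
Proof.
move=> z1; apply: le_lt_trans (l1norm_at_fin x (cvalP a)); apply: l1norm_le => k.
by rewrite cabsM circle_expz// mulr1.
Qed.

Lemma psi_mono x z k f (cf : continuous f) (sf : forall y, f y != 0 -> Fix k y) :
  psi sigma sigmai x z (MkComm (in_comm_mono cf sf)) = f x * z ^ k.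
Proof.
rewrite /psi /= -[RHS](sumZ_delta k); congr sumZ; apply/funext => j.
by rewrite /monoZ /deltaZ; case: eqP => [->//|_]; rewrite mul0r.
Qed.

Lemma psi_character x (z : Cplx R) : circle z -> is_character (psi sigma sigmai x z).
Proof.
move=> z1; have z0 := circle_neq0 z1; split.
- move=> a b c cE; rewrite /psi cE -sumZD; try exact: psi_fin.
  by congr sumZ; apply/funext => k; rewrite mulrDl.
- move=> l a c cE; rewrite /psi cE -sumZM; last exact: psi_fin.
  by congr sumZ; apply/funext => k; rewrite mulrA.
- move=> a b c cE; rewrite /psi -sumZ_conv; try exact: psi_fin.
  congr sumZ; apply/funext => n; rewrite cE l1mulE; last exact: cvalP.
  rewrite /convZ mulrC -sumZM; last first.
    exact: l1norm_conv_term_fin (l1norm_at_fin x (cvalP a)) (l1norm_at_fin x (cvalP b)).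
  congr sumZ; apply/funext => k.
  (* Splitting z^n as z^(n-k) z^k turns the convolution of the coefficients into that of the twisted
     sequences. *)
  rewrite -{1}(subrK k n) (expfzDr _ _ z0); ring.
- have c1 : continuous (fun _ : X => 1 : Cplx R) by move=> y; exact: cst_continuous.
  exists (MkComm (in_comm_mono c1 (@Fix0 (fun=> 1)))).
  by rewrite psi_mono expr0z mulr1 oner_neq0.
Qed.

(** The limit is taken within the circle: the majorant [supn (a k)] relies on |z^k| = 1 and would
    fail for nearby z off it. *)
Lemma psi_cvg (a : Comm) x (z : Cplx R) : circle z ->
  (fun q : X * Cplx R => psi sigma sigmai q.1 q.2 a) @
    within [set q | circle q.2] (nbhs (x, z)) --> psi sigma sigmai x z a.
Proof.
move=> z1.
have bd (y : X) (w : Cplx R) k : circle w -> cabs (a k y * w ^ k) <= supn (a k).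
  by move=> w1; rewrite cabsM circle_expz// mulr1; apply/cabs_le_supn/in_comm_cont/cvalP.
apply: (@sumZ_dominated_cvg R _ _ _ (fun k q => a k q.1 * q.2 ^ k)
  (fun k => a k x * z ^ k) (fun k => supn (a k))).
- exact: in_comm_fin (cvalP a).
- move=> k; apply: cvgM.
    apply: (@cvg_trans _ ((fun q : X * Cplx R => a k q.1) @ nbhs (x, z))).
      by apply: cvg_app; exact: cvg_within.
    apply: (@continuous_comp _ _ _ fst (a k) (x, z)); first exact: cvg_fst.
    exact: in_comm_cont (cvalP a) k x.
  apply/cvg_cplxP => e e0.
  (* The Lipschitz constant |k| is 0 in degree 0, hence the shift by 1 before dividing. *)
  have k1 : 0 < `|k|%N%:R + 1 :> R by rewrite ltr_wpDl.
  have : \forall q \near nbhs (x, z), cabs (q.2 - z) < e / (`|k|%N%:R + 1).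
    have /cvg_cplxP : (fun q : X * Cplx R => q.2) @ nbhs (x, z) --> z by exact: cvg_snd.
    by apply; rewrite divr_gt0.
  apply: filterS => q hq q1.
  apply: le_lt_trans (circle_expz_dist k q1 z1) _.
  move: hq; rewrite ltr_pdivlMr//; apply: le_lt_trans.
  by rewrite mulrC ler_wpM2l ?cabs_ge0// lerDl.
- by rewrite near_withinE; apply: filterE => q q1 k; exact: bd.
- by move=> k; exact: bd.
Qed.

Lemma psi_near (a : Comm) x (z : Cplx R) e : circle z -> 0 < e ->
  \forall q \near nbhs (x, z), circle q.2 ->
    cabs (psi sigma sigmai q.1 q.2 a - psi sigma sigmai x z a) < e.
Proof. by move=> z1 e0; have /cvg_cplxP /(_ _ e0) := @psi_cvg a x z z1. Qed.

Lemma gelfand_open_preimage (U : set (Comm -> Cplx R)) : gelfand_open U ->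
  open_in_XT [set p : X * Cplx R | circle p.2 /\ U (psi sigma sigmai p.1 p.2)].
Proof.
move=> oU.
(* [W] is stated as an implication so that it contains everything off the circle; its interior can
   then be an open set of X x C with the prescribed trace. *)
pose W := [set p : X * Cplx R | circle p.2 -> U (psi sigma sigmai p.1 p.2)].
exists W°; split; first exact: open_interior.
apply/seteqP; split=> -[x z] /=; last first.
  by move=> [/interior_subset W1 z1]; split=> //; split=> //; exact: W1.
move=> [[z1 Up] _]; split=> //.
have [m [a [e [e0 ha]]]] := oU _ Up.
have : \forall q \near nbhs (x, z), forall i, circle q.2 ->
    cabs (psi sigma sigmai q.1 q.2 (a i) - psi sigma sigmai x z (a i)) < e.
  by apply: filter_forall => i; exact: psi_near.
apply: filterS => q hq q1; apply: ha; first exact: psi_character.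
by move=> i; exact: hq.
Qed.

(* X x T is compact, so characters psi_q with q outside an open saturated set that
   approach phi accumulate at a point of the fibre of phi. *)
Lemma preimage_open_gelfand (U : set (Comm -> Cplx R)) :
  U `<=` (@is_character R X sigma sigmai) ->
  open_in_XT [set p : X * Cplx R | circle p.2 /\ U (psi sigma sigmai p.1 p.2)] ->
  gelfand_open U.
Proof.
move=> Uchar [V [oV WV]] phi Uphi; apply: contrapT => nex.
(* [F] is generated by the preimages of the basic neighbourhoods of phi, cut down to the points of X
   x T that psi sends outside [U]. *)
pose F := [set A : set (X * Cplx R) | exists (m : nat) (a : 'I_m -> Comm) (e : R), 0 < e /\
  forall q, circle q.2 -> ~ U (psi sigma sigmai q.1 q.2) ->
    (forall i, cabs (psi sigma sigmai q.1 q.2 (a i) - phi (a i)) < e) -> A q].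
pose c0 : Comm := MkComm in_comm0.
have FT (A : set (X * Cplx R)) :
    (forall q, circle q.2 -> ~ U (psi sigma sigmai q.1 q.2) -> A q) -> F A.
  by move=> hA; exists 0%N, (fun=> c0), 1; split=> // q q1 nU _; exact: hA.
have FF : Filter F.
  split.
  - exact: FT.
  - move=> A B [m [a [e [e0 hA]]]] [n [b [d [d0 hB]]]].
    exists (m + n)%N,
      (fun i => match fintype.split i with inl j => a j | inr j => b j end), (Num.min e d).
    split; first by rewrite lt_min e0.
    move=> q q1 nU h; split.
      apply: hA => // i; have := h (unsplit (inl i)); rewrite unsplitK lt_min.
      by case/andP.
    apply: hB => // i; have := h (unsplit (inr i)); rewrite unsplitK lt_min.
    by case/andP.
  - move=> A B AB [m [a [e [e0 hA]]]]; exists m, a, e; split=> // q q1 nU h.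
    by apply: AB; exact: hA.
(* If such a trace were empty, then, every character being some psi_q, a whole basic neighbourhood
   of phi would lie in [U], against [nex]. *)
have FP : ProperFilter F.
  split=> // -[m [a [e [e0 hA]]]]; apply: nex; exists m, a, e; split=> // phi' cphi' h.
  apply: contrapT => nU; have [x [z [z1 pE]]] := char_psi cphi'.
  by apply: (hA (x, z)) => //=; rewrite pE.
have cXT : compact ([set: X] `*` @circle R) by apply: compact_setX => //; exact: circle_compact.
have [|[x z] [[_ /= z1] clF]] := cXT _ FP; first by apply: FT => q q1 _; split.
(* Along [F] the values of psi at each a tend to phi(a), and psi is continuous at the cluster point;
   this is where the Hausdorff property of the target acts. *)
have pE : psi sigma sigmai x z = phi.
  apply/funext => a; apply/eqP; rewrite -subr_eq0; apply/eqP; apply: cabs_eq0.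
  apply/le_anti; rewrite cabs_ge0 andbT; apply/ler_addgt0Pr => e e0; rewrite add0r.
  have e2 : 0 < e / 2 by rewrite divr_gt0.
  have FA : F [set q | circle q.2 /\ cabs (psi sigma sigmai q.1 q.2 a - phi a) < e / 2].
    exists 1%N, (fun=> a), (e / 2); split=> // q q1 _ h; split=> //; exact: (h ord0).
  have [q [[q1 h1] h2]] := clF _ _ FA (psi_near a x z1 e2).
  apply: le_trans (cabs_dist _ (psi sigma sigmai q.1 q.2 a) _) _.
  by rewrite [e]splitr lerD// ?(ltW h1)// cabsB ltW// h2.
have Vp : nbhs (x, z) V.
  apply: open_nbhs_nbhs; split=> //.
  suff [] : (V `&` [set p | circle p.2]) (x, z) by [].
  by rewrite -WV; split=> //; split=> //=; rewrite pE.
have FB : F [set q | circle q.2 /\ ~ U (psi sigma sigmai q.1 q.2)] by apply: FT.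
have [q [[q1 nU] Vq]] := clF _ _ FB Vp.
apply: nU; suff [[]] : ([set p : X * Cplx R | circle p.2 /\ U (psi sigma sigmai p.1 p.2)]
  `&` [set p | circle p.2]) q by [].
by rewrite WV.
Qed.

(** * The fibres of psi *)

Lemma psi_eq_omega0 x : ~ (exists q : nat, (0 < q)%N /\ interior (Fix q%:Z) x) ->
  forall y (z : Cplx R), circle z -> (psi sigma sigmai y z = omega0 x <-> y = x).
Proof.
move=> nox y z z1; split=> [pE|->]; last first.
  apply/funext => a; rewrite /psi /omega0 -[RHS](sumZ_delta 0); congr sumZ.
  apply/funext => k; rewrite /deltaZ; have [->|k0] := eqVneq k 0.
    by rewrite expr0z mulr1.
  have [->|/(in_comm_interior (cvalP a)) kx] := eqVneq (a k x) 0; first by rewrite mul0r.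
  exfalso; apply: nox; exists `|k|%N; split; first by rewrite absz_gt0.
  by case: (k) kx => // n; rewrite NegzE => /(Fix_interiorN sK siK); rewrite opprK abszN.
apply: contrapT => yx; have [f [cf fx fy]] := separating_function yx.
have := congr1 (fun p => p (MkComm (in_comm_mono cf (@Fix0 f)))) pE.
rewrite psi_mono fy mul0r /omega0 /= /monoZ /deltaZ eqxx fx => /esym/eqP.
by rewrite oner_eq0.
Qed.

Lemma omega_mono x c (n : nat) j f (cf : continuous f)
    (sf : forall y, f y != 0 -> Fix (j * n%:Z) y) : (0 < n)%N ->
  omega sigma sigmai x c n (MkComm (in_comm_mono cf sf)) = f x * c ^ j.
Proof.
move=> n0; rewrite /omega /= -[RHS](sumZ_delta j); congr sumZ; apply/funext => i.
rewrite /monoZ /deltaZ; have ni : n%:Z != 0 by rewrite eqz_nat -lt0n.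
by rewrite (inj_eq (mulIf ni)); case: eqP => [->//|_]; rewrite mul0r.
Qed.

Lemma psi_eq_omega x (n : nat) : (0 < n)%N -> interior (Fix n%:Z) x ->
  (forall m : nat, (0 < m < n)%N -> ~ interior (Fix m%:Z) x) ->
  forall c : Cplx R, circle c -> forall y (z : Cplx R), circle z ->
  (psi sigma sigmai y z = omega sigma sigmai x c n <-> y = x /\ z ^+ n = c).
Proof.
move=> n0 hn nmin c c1 y z z1; split=> [pE|[-> zn]]; last first.
  apply/funext => a; pose v k := a k x * z ^ k.
  have ni : n%:Z != 0 by rewrite eqz_nat -lt0n.
  (* Only degrees divisible by the minimal period contribute at x, so the sum can be reindexed along
     j -> jn. *)
  have vn k : v k != 0 -> exists j, j * n%:Z = k.
    move=> vk; have ak : a k x != 0 by apply: contraNneq vk; rewrite /v => ->; rewrite mul0r.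
    have [j ->] := Fix_interior_dvd sK siK n0 hn nmin (in_comm_interior (cvalP a) ak).
    by exists j.
  transitivity (sumZ v); first by [].
  rewrite -(sumZ_reindex (mulIf ni) vn (psi_fin x a z1)).
  congr sumZ; apply/funext => j; rewrite /v /= -zn; congr (_ * _).
  by rewrite mulrC -exprz_exp.
have yx : y = x.
  apply: contrapT => yx; have [f [cf fx fy]] := separating_function yx.
  (* Degree 0 is written as 0 * n to match the form in which [omega_mono] evaluates monomials. *)
  have sf t : f t != 0 -> Fix (0 * n%:Z) t by rewrite mul0r.
  have := congr1 (fun p => p (MkComm (in_comm_mono cf sf))) pE.
  rewrite psi_mono (omega_mono _ _ _ _ n0) fy fx mul0r mul1r expr0z => /esym/eqP.
  by rewrite oner_eq0.
split; first exact: yx.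
(* With y = x known, testing on u delta^n, where u(x) = 1, reads off z^n on one side and c on the
   other. *)
have [u [cu _ ux un]] := urysohn_point hn.
pose f t : Cplx R := (u t)%:C%C.
have cf : continuous f by move=> t; apply: (@continuous_RtoC R X u); exact: cu.
have sf t : f t != 0 -> Fix (1 * n%:Z) t.
  by move=> ft; rewrite mul1r; apply: un; apply: contraNneq ft; rewrite /f => ->.
have := congr1 (fun p => p (MkComm (in_comm_mono cf sf))) pE.
by rewrite psi_mono (omega_mono _ _ _ _ n0) yx /f ux !mul1r expr1z.
Qed.

End Families.

Unset Implicit Arguments.

Theorem theorem3p10 (R : realType) (X : topologicalType) (sigma sigmai : X -> X) :
  compact [set: X] -> hausdorff_space X -> [set: X] !=set0 ->
  continuous sigma -> continuous sigmai ->
  cancel sigma sigmai -> cancel sigmai sigma ->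
  (* psi maps X x T into Delta(C(X)'_1) *)
  (forall (x : X) (z : Cplx R), circle z -> is_character (psi sigma sigmai x z)) /\
  (* psi is surjective *)
  (forall phi, is_character phi ->
     exists (x : X) (z : Cplx R), circle z /\ psi sigma sigmai x z = phi) /\
  (* continuity + quotient: U in Delta is Gelfand-open iff psi^{-1}(U) is open in X x T *)
  (forall U : set (Comm R sigma sigmai -> Cplx R), U `<=` (@is_character R X sigma sigmai) ->
     (gelfand_open U <->
      open_in_XT [set p : X * Cplx R | circle p.2 /\ U (psi sigma sigmai p.1 p.2)])) /\
  (* fiber (i) *)
  (forall x : X, ~ (exists q : nat, (0 < q)%N /\ interior (Fix sigma sigmai q%:Z) x) ->
     forall (y : X) (z : Cplx R), circle z ->
       (psi sigma sigmai y z = omega0 x <-> y = x)) /\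
  (* fiber (ii) *)
  (forall (x : X) (n : nat), (0 < n)%N -> interior (Fix sigma sigmai n%:Z) x ->
     (forall m : nat, (0 < m < n)%N -> ~ interior (Fix sigma sigmai m%:Z) x) ->
     forall c : Cplx R, circle c ->
     forall (y : X) (z : Cplx R), circle z ->
       (psi sigma sigmai y z = omega sigma sigmai x c n <-> y = x /\ z ^+ n = c)).
Proof.
move=> cX hX [x0 _] cs csi sK siK; split; [|split; [|split; [|split]]].
- by move=> x z; exact: psi_character.
- by move=> phi; exact: char_psi.
- move=> U Uchar; split; first exact: gelfand_open_preimage.
  exact: preimage_open_gelfand.
- by move=> x nox; exact: psi_eq_omega0.
- by move=> x n n0 hn nmin; exact: psi_eq_omega.
Qed.
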